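(* The abscissa of convergence of the global normal zeta function $\zeta^{\triangleleft}_{F_{2,4}}(s)=\sum_{n=1}^\infty a_n^{\triangleleft}(F_{2,4})n^{-s}$ is $4$.
   Context: $F_{2,4}=F_4/\gamma_3(F_4)$ is the free nilpotent group of class two on four generators ($F_4$ the free group on four generators, $\gamma_3$ the third term of the lower central series). $a_n^{\triangleleft}(G)$ denotes the number of normal subgroups of index $n$ in $G$. The abscissa of convergence is that of the Dirichlet series. *)

(* Defs.v *)
From HB Require Import structures.
From mathcomp Require Import all_boot all_order all_algebra.
From mathcomp Require Import all_classical all_reals all_analysis.
From mathcomp Require Import finmap complex.
Import Order.TTheory GRing.Theory Num.Theory numFieldNormedType.Exports.

Set Implicit Arguments.
Unset Strict Implicit.
Unset Printing Implicit Defensive.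

Local Open Scope classical_set_scope.
Local Open Scope quotient_scope.
Local Open Scope group_scope.

Section Subgroups.
Variable G : groupType.
Implicit Types H A B : set G.

Definition is_subgroup H : Prop := group_closed (mem H).

Definition is_normal_subgroup H : Prop :=
  is_subgroup H /\ forall x y : G, H x -> H (x ^ y).

Definition commutator_subgroup A B : set G :=
  smallest is_subgroup [set [~ x, y] | x in A & y in B].

(* gamma_1 = G and gamma_(i+1) = [gamma_i, G]; the value at 0 is also G. *)
Definition lower_central (i : nat) : set G :=
  iter i.-1 (fun H => commutator_subgroup H setT) setT.

Definition left_cosets H : set (set G) :=
  [set [set g * h | h in H] | g in setT].

Definition has_index H (n : nat) : Prop := (left_cosets H #= `I_n)%card.

(* [fset_set] returns the empty set on an infinite set; when G is finitely
   generated the set below is finite for every n. *)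
Definition num_normal_subgroups (n : nat) : nat :=
  #|` fset_set [set H : set G | is_normal_subgroup H /\ has_index H n] |.

Lemma is_subgroupP H : is_subgroup H <->
  [/\ H 1, forall x y, H x -> H y -> H (x * y) & forall x, H x -> H x^-1].
Proof.
rewrite /is_subgroup; split.
  case=> h1 hd; have H1 : H 1 by rewrite -in_setE.
  have HV x : H x -> H x^-1.
    by move=> Hx; rewrite -in_setE -[x^-1]mul1g; apply: hd; rewrite in_setE.
  split=> // x y Hx Hy; rewrite -in_setE -[y]invgK.
  by apply: hd; rewrite in_setE//; apply: HV.
case=> h1 hM hV; split; first by rewrite in_setE.
move=> x y; rewrite !in_setE => Hx Hy.
by apply: hM => //; apply: hV.
Qed.

Lemma is_subgroup_setT : is_subgroup setT.
Proof. exact/is_subgroupP. Qed.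

Lemma is_subgroup_smallest A : is_subgroup (smallest is_subgroup A).
Proof.
apply/is_subgroupP; split=> [B [/is_subgroupP[]//]|x y Ax Ay|x Ax] B BA;
  have [/is_subgroupP[_ BM BV] _] := BA.
- by apply: BM; [apply: Ax | apply: Ay].
- by apply: BV; apply: Ax.
Qed.

Lemma lower_central_normal i : is_normal_subgroup (lower_central i).
Proof.
rewrite /lower_central; elim: i.-1 => [|k [_ IH]] /=.
  by split=> //; exact: is_subgroup_setT.
split=> [|x y Hx B [gB AB]]; first exact: is_subgroup_smallest.
have /is_subgroupP[B1 BM BV] := gB.
apply: (Hx [set z | B (z ^ y)]); split.
  apply/is_subgroupP; split=> [|a b /= Ba Bb|a /= Ba].
  - by rewrite /= conj1g.
  - by rewrite conjMg; apply: BM.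
  - by rewrite conjVg; apply: BV.
move=> _ [a Ha] [b _ <-] /=; apply: AB; rewrite conjRg.
by exists (a ^ y); [exact: IH | exists (b ^ y)].
Qed.

End Subgroups.

Record normal_subgroup (G : groupType) := NormalSubgroup {
  normal_set : set G;
  normal_setP : is_normal_subgroup normal_set
}.

Section NormalSubgroupTheory.
Variables (G : groupType) (N : normal_subgroup G).

Lemma normal_set1 : normal_set N 1.
Proof. by have [/is_subgroupP[]] := normal_setP N. Qed.

Lemma normal_setM x y :
  normal_set N x -> normal_set N y -> normal_set N (x * y).
Proof. by have [/is_subgroupP[_ NM _] _] := normal_setP N; exact: NM. Qed.

Lemma normal_setV x : normal_set N x -> normal_set N x^-1.
Proof. by have [/is_subgroupP[_ _ NV] _] := normal_setP N; exact: NV. Qed.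

Lemma normal_setJ x y : normal_set N x -> normal_set N (x ^ y).
Proof. by have [_] := normal_setP N; exact. Qed.

End NormalSubgroupTheory.

Section QuotientGroup.
Variables (G : groupType) (N : normal_subgroup G).

Definition same_coset : rel G := fun x y => `[< normal_set N (x^-1 * y) >].

Lemma same_coset_refl : reflexive same_coset.
Proof. by move=> x; apply/asboolP; rewrite mulVg; exact: normal_set1. Qed.

Lemma same_coset_sym : symmetric same_coset.
Proof.
by move=> x y; apply/asboolP/asboolP => /normal_setV; rewrite invgM invgK.
Qed.

Lemma same_coset_trans : transitive same_coset.
Proof.
move=> y x z /asboolP xy /asboolP yz; apply/asboolP.
by rewrite -(mulVKg y z) mulgA; exact: normal_setM.
Qed.

Canonical same_coset_equiv :=
  EquivRel same_coset same_coset_refl same_coset_sym same_coset_trans.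

Definition quotient_group := {eq_quot same_coset}.
HB.instance Definition _ : EqQuotient _ same_coset quotient_group :=
  EqQuotient.on quotient_group.
HB.instance Definition _ := Choice.on quotient_group.

Definition quotient_proj (x : G) : quotient_group := \pi x.
Definition quotient_one : quotient_group := quotient_proj 1.
Definition quotient_mul (a b : quotient_group) : quotient_group :=
  quotient_proj (repr a * repr b).
Definition quotient_inv (a : quotient_group) : quotient_group :=
  quotient_proj (repr a)^-1.

Lemma quotient_projP x y :
  quotient_proj x = quotient_proj y <-> normal_set N (x^-1 * y).
Proof.
split=> [/eqquotP/asboolP//|Nxy]; apply/eqquotP; exact/asboolP.
Qed.

Lemma quotient_reprK a : quotient_proj (repr a) = a.
Proof. exact: reprK. Qed.

Lemma quotient_mulE x y :
  quotient_mul (quotient_proj x) (quotient_proj y) = quotient_proj (x * y).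
Proof.
rewrite /quotient_mul; apply/quotient_projP.
set x' := repr _; set y' := repr _.
have /quotient_projP Nx : quotient_proj x' = quotient_proj x.
  exact: quotient_reprK.
have /quotient_projP Ny : quotient_proj y' = quotient_proj y.
  exact: quotient_reprK.
have -> : (x' * y')^-1 * (x * y) = (x'^-1 * x) ^ y' * (y'^-1 * y).
  by rewrite conjgE invgM !mulgA mulgK.
by apply: normal_setM => //; apply: normal_setJ.
Qed.

Lemma quotient_invE x : quotient_inv (quotient_proj x) = quotient_proj x^-1.
Proof.
rewrite /quotient_inv; apply/esym/quotient_projP; rewrite invgK.
set x' := repr _.
have /quotient_projP Nx : quotient_proj x' = quotient_proj x.
  exact: quotient_reprK.
have -> : x * x'^-1 = (x'^-1 * x) ^ x'^-1.
  by rewrite conjgE invgK mulgA mulVKg.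
exact: normal_setJ.
Qed.

Lemma quotient_mulA : associative quotient_mul.
Proof.
move=> a b c.
rewrite -(quotient_reprK a) -(quotient_reprK b) -(quotient_reprK c).
move: (repr a) (repr b) (repr c) => x y z.
by rewrite (quotient_mulE x y) (quotient_mulE y z) !quotient_mulE mulgA.
Qed.

Lemma quotient_mul1 : left_id quotient_one quotient_mul.
Proof.
by move=> a; rewrite -(quotient_reprK a) (quotient_mulE 1) mul1g.
Qed.

Lemma quotient_mulr1 : right_id quotient_one quotient_mul.
Proof.
by move=> a; rewrite -(quotient_reprK a) (quotient_mulE _ 1) mulg1.
Qed.

Lemma quotient_mulV : left_inverse quotient_one quotient_inv quotient_mul.
Proof.
move=> a; rewrite -(quotient_reprK a); move: (repr a) => x.
by rewrite quotient_invE (quotient_mulE x^-1 x) mulVg.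
Qed.

Lemma quotient_mulrV : right_inverse quotient_one quotient_inv quotient_mul.
Proof.
move=> a; rewrite -(quotient_reprK a); move: (repr a) => x.
by rewrite quotient_invE (quotient_mulE x x^-1) mulgV.
Qed.

HB.instance Definition _ := isGroup.Build quotient_group
  quotient_mulA quotient_mul1 quotient_mulr1 quotient_mulV quotient_mulrV.

End QuotientGroup.

Section FreeGroup.
Variable X : choiceType.

(* The letter (x, b) stands for x if b = false and for x^-1 if b = true. *)
Definition word := seq (X * bool).

Inductive word_eq : word -> word -> Prop :=
| word_eq_refl u : word_eq u u
| word_eq_sym u v : word_eq u v -> word_eq v u
| word_eq_trans v u w : word_eq u v -> word_eq v w -> word_eq u w
| word_eq_cancel u v x b : word_eq (u ++ [:: (x, b); (x, ~~ b)] ++ v) (u ++ v).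

Definition word_inv (u : word) : word := rev [seq (l.1, ~~ l.2) | l <- u].

Lemma word_eq_cat u u' v v' :
  word_eq u u' -> word_eq v v' -> word_eq (u ++ v) (u' ++ v').
Proof.
move=> uu' vv'; apply: (word_eq_trans (v := u' ++ v)).
  elim: uu' => {vv'} [w|a b _ IH|a b c _ IH1 _ IH2|a b x e].
  - exact: word_eq_refl.
  - exact: word_eq_sym.
  - exact: word_eq_trans IH1 IH2.
  - by rewrite -!catA; exact: word_eq_cancel.
elim: vv' => [w|a b _ IH|a b c _ IH1 _ IH2|a b x e].
- exact: word_eq_refl.
- exact: word_eq_sym.
- exact: word_eq_trans IH1 IH2.
- by rewrite !(catA u'); exact: word_eq_cancel.
Qed.

Lemma word_inv_cat u v : word_inv (u ++ v) = word_inv v ++ word_inv u.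
Proof. by rewrite /word_inv map_cat rev_cat. Qed.

Lemma word_invK : involutive word_inv.
Proof.
move=> u; rewrite /word_inv map_rev revK -map_comp map_id_in// => -[x b] _ /=.
by rewrite negbK.
Qed.

Lemma word_eq_inv u v : word_eq u v -> word_eq (word_inv u) (word_inv v).
Proof.
elim=> [w|a b _ IH|a b c _ IH1 _ IH2|a b x e].
- exact: word_eq_refl.
- exact: word_eq_sym.
- exact: word_eq_trans IH1 IH2.
- rewrite !word_inv_cat -catA {2}/word_inv /rev /= negbK.
  exact: word_eq_cancel.
Qed.

Lemma word_mulV u : word_eq (word_inv u ++ u) [::].
Proof.
elim: u => [|[x b] u IH]; first exact: word_eq_refl.
rewrite -cat1s word_inv_cat -catA; apply: word_eq_trans IH.
by have := word_eq_cancel (word_inv u) u x (~~ b); rewrite negbK.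
Qed.

Definition free_rel : rel word := fun u v => `[< word_eq u v >].

Lemma free_rel_refl : reflexive free_rel.
Proof. by move=> u; apply/asboolP; exact: word_eq_refl. Qed.

Lemma free_rel_sym : symmetric free_rel.
Proof. by move=> u v; apply/asboolP/asboolP; exact: word_eq_sym. Qed.

Lemma free_rel_trans : transitive free_rel.
Proof.
move=> v u w /asboolP uv /asboolP vw; apply/asboolP.
exact: word_eq_trans uv vw.
Qed.

Canonical free_equiv :=
  EquivRel free_rel free_rel_refl free_rel_sym free_rel_trans.

Definition free_group := {eq_quot free_rel}.
HB.instance Definition _ : EqQuotient _ free_rel free_group :=
  EqQuotient.on free_group.
HB.instance Definition _ := Choice.on free_group.

Definition free_proj (u : word) : free_group := \pi u.
Definition free_one : free_group := free_proj [::].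
Definition free_mul (a b : free_group) : free_group :=
  free_proj (repr a ++ repr b).
Definition free_inv (a : free_group) : free_group :=
  free_proj (word_inv (repr a)).

Lemma free_projP u v : free_proj u = free_proj v <-> word_eq u v.
Proof.
split=> [/eqquotP/asboolP//|uv]; apply/eqquotP; exact/asboolP.
Qed.

Lemma free_reprK a : free_proj (repr a) = a.
Proof. exact: reprK. Qed.

Lemma free_mulE u v : free_mul (free_proj u) (free_proj v) = free_proj (u ++ v).
Proof. by apply/free_projP/word_eq_cat; apply/free_projP/free_reprK. Qed.

Lemma free_invE u : free_inv (free_proj u) = free_proj (word_inv u).
Proof. exact/free_projP/word_eq_inv/free_projP/free_reprK. Qed.

Lemma free_mulA : associative free_mul.
Proof.
move=> a b c; rewrite -(free_reprK a) -(free_reprK b) -(free_reprK c).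
move: (repr a) (repr b) (repr c) => u v w.
by rewrite (free_mulE u v) (free_mulE v w) !free_mulE catA.
Qed.

Lemma free_mul1 : left_id free_one free_mul.
Proof. by move=> a; rewrite -(free_reprK a) (free_mulE [::]). Qed.

Lemma free_mulr1 : right_id free_one free_mul.
Proof. by move=> a; rewrite -(free_reprK a) (free_mulE _ [::]) cats0. Qed.

Lemma free_mulV : left_inverse free_one free_inv free_mul.
Proof.
move=> a; rewrite -(free_reprK a); move: (repr a) => u.
by rewrite free_invE (free_mulE _ u); apply/free_projP/word_mulV.
Qed.

Lemma free_mulrV : right_inverse free_one free_inv free_mul.
Proof.
move=> a; rewrite -(free_reprK a); move: (repr a) => u.
rewrite free_invE (free_mulE u); apply/free_projP.
by rewrite -{1}[u]word_invK; exact: word_mulV.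
Qed.

HB.instance Definition _ := isGroup.Build free_group
  free_mulA free_mul1 free_mulr1 free_mulV free_mulrV.

End FreeGroup.

(* F_(c,d) = F_d / gamma_(c+1)(F_d) *)
Definition free_nilpotent (c d : nat) : groupType :=
  quotient_group (NormalSubgroup
    (@lower_central_normal (free_group 'I_d) c.+1)).

Section DirichletSeries.
Variable R : realType.
Local Open Scope ring_scope.
Local Open Scope complex_scope.

Definition cexp (z : R[i]) : R[i] :=
  (expR (complex.Re z) * cos (complex.Im z)) +i*
  (expR (complex.Re z) * sin (complex.Im z)).

(* n^(-s), for n > 0 *)
Definition dirichlet_power (n : nat) (s : R[i]) : R[i] :=
  cexp (- s * (ln n%:R)%:C).

(* The series starts at n = 1, so its term of index n is a_(n+1) (n+1)^(-s).
   The type cast selects the norm topology on R[i]. *)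
Definition dirichlet_cvg (a : nat -> R[i]) (s : R[i]) : Prop :=
  cvgn (series (fun n => a n.+1 * dirichlet_power n.+1 s
                  : (R[i] : numFieldType))).

Definition abscissa_of_convergence (a : nat -> R[i]) : \bar R :=
  ereal_inf [set sigma%:E | sigma in
    [set sigma : R |
      forall s : R[i], sigma < complex.Re s -> dirichlet_cvg a s]].

Definition normal_zeta_coef (G : groupType) (n : nat) : R[i] :=
  (num_normal_subgroups G n)%:R.

End DirichletSeries.

(* Main.v *)
Require Import Defs.
From mathcomp Require Import all_boot all_order all_algebra.
From mathcomp Require Import all_classical all_reals all_analysis.
From mathcomp Require Import finmap complex zify ring lra.
Import Order.TTheory GRing.Theory Num.Theory numFieldNormedType.Exports.

Set Implicit Arguments.
Unset Strict Implicit.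
Unset Printing Implicit Defensive.

(** Write G = F_(2,4), with generators x_0, .., x_3 and with derived group
    Z^6, spanned by the commutators y_ij of the x's and central in G.

    The abscissa is at least 4 because G maps onto Z^4: the homomorphisms
    Z^4 -> Z/n that send the first basis vector to 1 have n^3 distinct kernels,
    all of index n, so a_n >= n^3 ([num_normal_subgroups_ge]).  At s = 4 the
    series dominates the harmonic series ([dirichlet_dvg_4]).

    It is at most 4 because of the following count.  Every element of G is a
    word x^a y^c with a in Z^4 and c in Z^6.  A normal subgroup H of finite index
    has a central part N = H /\ Z^6 and an image M in Z^4, and commuting H with
    the generators shows that M lies in the lattice X = X(N) of all a such that
    a /\ b lies in N for every b.  Conversely H is recovered from N, from M and
    from one lift to G, modulo N, of each vector in a basis of M.  Choose
    Hermite bases: one of N with pivots n_e, one of X, and one of M relative to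
    the basis of X with pivots q_i.  The number of subgroups H with these pivots
    is at most prod_i q_i^i * prod_e n_e^(e + 4), and the index of H is at least
    prod_i q_i * |Z^4 : X| * prod_e n_e ([hermite_subgroup_exists],
    [num_normal_subgroups_sum_le]).  Hence the series is dominated by
      zeta(s) zeta(s - 1) zeta(s - 2) zeta(s - 3)
        * sum_(n_e) prod_e n_e^(e + 4 - s) * |Z^4 : X|^(-s),
    where the zeta factors come from the q_i and converge exactly for s > 4.

    To bound |Z^4 : X| from below, list the pairs ij in colexicographic order.
    The wedge of the i-th basis vector of X with a basis vector of Z^4 then has
    a known leading coordinate, which forces the pivot n_ij of N to divide the
    i-th and the j-th pivot of X ([wedge_lead_lo], [wedge_lead_hi]).  So the
    i-th pivot of X is at least the least common multiple of the n_ij over j.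
    The remaining sum over six integers is bounded by summing out one variable
    at a time, each time with the estimate
      sum_n n^w lcm(n, A)^(-a) <= C A^(w - a + d)
    of [lcm_sum_le], whose small loss d is the divisor bound tau(A) << A^d
    ([pivot_sum_bounded]).  There is no room to spare: when all six pivots equal
    p, the weights 0 + 1 + .. + 5 = 15 meet the exponent 4 * 4 = 16, which
    leaves p^(-1) at s = 4 and something summable as soon as s > 4. *)

(** * Divisors, least common multiples and sums over pivots *)
Section DivisorBound.
Variable R : realType.
Local Open Scope ring_scope.
Implicit Types (d x : R) (n : nat).

(** A divisor g of u v is determined by gcd(g, u) and its cofactor. *)
Lemma size_divisorsM u v : (0 < u)%N -> (0 < v)%N ->
  (size (divisors (u * v)) <= size (divisors u) * size (divisors v))%N.
Proof.
move=> u0 v0; have uv0 : (0 < u * v)%N by rewrite muln_gt0 u0.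
rewrite -(size_allpairs (fun a b => (a * b)%N)).
apply: uniq_leq_size; first exact: divisors_uniq.
move=> g; rewrite -dvdn_divisors// => guv.
apply/allpairsP; exists (gcdn g u, g %/ gcdn g u)%N => /=.
have g0 : (0 < g)%N by apply: dvdn_gt0 guv.
have d0 : (0 < gcdn g u)%N by rewrite gcdn_gt0 g0.
split; first by rewrite -dvdn_divisors// dvdn_gcdr.
  rewrite -dvdn_divisors// -(dvdn_pmul2l d0).
  rewrite mulnC divnK ?dvdn_gcdl// muln_gcdl dvdn_gcd guv andbT.
  exact: dvdn_mulr.
by rewrite mulnC divnK ?dvdn_gcdl.
Qed.

Lemma size_divisors_pfactor p a : prime p ->
  (size (divisors (p ^ a)) <= a.+1)%N.
Proof.
move=> pp; have -> : a.+1 = size (map (expn p) (iota 0 a.+1)) by rewrite size_map size_iota.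
apply: uniq_leq_size; first exact: divisors_uniq.
move=> g.
rewrite -dvdn_divisors ?expn_gt0 ?prime_gt0// => /(dvdn_pfactor _ _ pp)[m ma ->].
by apply: map_f; rewrite mem_iota /= add0n ltnS.
Qed.

Lemma powR_natX (n a : nat) d : (n ^ a)%:R `^ d = n%:R `^ (a%:R * d) :> R.
Proof. by rewrite natrX -powR_mulrn// -powRrM. Qed.

(** The divisor bound tau(n) << n^d.  A prime power p^a contributes a + 1 to
    tau: this is at most p^(a d) once p^d >= 2, and at most c p^(a d) in any case,
    so that c^P0 is a constant for all n as soon as p^d >= 2 holds from P0 on. *)
Lemma size_divisors_le_powR d : 0 < d -> exists2 C : R, 1 <= C &
  forall n, (0 < n)%N -> (size (divisors n))%:R <= C * n%:R `^ d.
Proof.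
move=> d0; set c : R := 1 + (d * ln 2)^-1.
have l2 : 0 < ln 2 :> R by rewrite ln_gt0// ltr1n.
have dl : 0 < d * ln 2 by rewrite mulr_gt0.
have c1 : 1 <= c by rewrite lerDl invr_ge0 ltW.
have ple (p a : nat) x : 0 <= x -> (1 < p)%N -> 2 `^ (a%:R * x) <= p%:R `^ (a%:R * x) :> R.
  move=> x0 p1; apply: ge0_ler_powR; rewrite ?nnegrE ?mulr_ge0 ?ler_nat//.
have small (p a : nat) : (1 < p)%N -> a.+1%:R <= c * (p ^ a)%:R `^ d :> R.
  move=> p1; rewrite powR_natX; apply: le_trans (_ : c * 2 `^ (a%:R * d) <= _).
    rewrite /powR pnatr_eq0 /= -mulrA.
    apply: le_trans (_ : c * (1 + a%:R * (d * ln 2)) <= _); last first.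
      by rewrite ler_wpM2l ?expR_ge1Dx// (le_trans _ c1).
    rewrite /c; set y := d * ln 2 in dl *.
    have -> : (1 + y^-1) * (1 + a%:R * y) = 1 + a%:R * y + y^-1 + a%:R.
      by field; rewrite gt_eqF.
    rewrite -addn1 natrD.
    have : 0 <= a%:R * y :> R by rewrite mulr_ge0// ltW.
    have : 0 < y^-1 by rewrite invr_gt0.
    lra.
  by rewrite ler_wpM2l ?ple ?(le_trans _ c1)// ltW.
(* primes p >= P0 are those that cost nothing: p^d >= 2 gives a + 1 <= p^(a d) *)
have [P0 hP0] : exists P0 : nat, forall p : nat, (P0 <= p)%N -> 2 <= p%:R `^ d :> R.
  exists (Num.trunc (2 `^ d^-1 : R)).+1 => p hp.
  have -> : 2 = (2 `^ d^-1) `^ d :> R by rewrite -powRrM mulVf ?gt_eqF// powRr1.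
  apply: ge0_ler_powR; rewrite ?nnegrE ?powR_ge0// ?ltW//.
  apply: lt_le_trans (truncnS_gt _) _; by rewrite ler_nat.
have large (p a : nat) : (P0 <= p)%N -> (1 < p)%N -> a.+1%:R <= (p ^ a)%:R `^ d :> R.
  move=> pP p1; rewrite powR_natX mulrC powRrM powR_mulrn ?powR_ge0//.
  apply: le_trans (_ : 2 ^+ a <= _); last by rewrite lerXn2r ?nnegrE ?powR_ge0 ?hP0.
  by rewrite -natrX ler_nat ltn_expl.
exists (c ^+ P0); first by rewrite exprn_ege1.
(* induction on a strict bound K for the prime factors of n, splitting off
   the K-part when K is prime *)
suff H K n : (0 < n)%N -> (forall p, prime p -> p %| n -> (p < K)%N)%N ->
    (size (divisors n))%:R <= c ^+ (minn K P0) * n%:R `^ d.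
  move=> n n0; apply: le_trans (H n.+1 n n0 _) _.
    by move=> p _ pn; rewrite ltnS dvdn_leq.
  by rewrite ler_wpM2r ?powR_ge0// ler_weXn2l ?geq_minr.
elim: K n => [|K IH] n n0 hn.
  have -> : n = 1%N.
    apply/eqP; rewrite eqn_leq n0 andbT leqNgt; apply/negP => n1.
    by have := hn _ (pdiv_prime n1) (pdiv_dvd n).
  by rewrite min0n expr0 mul1r powR1.
have [pK|pK] := boolP (prime K); last first.
  apply: le_trans (IH n n0 _) _.
    move=> p pp pn; have := hn p pp pn; rewrite ltnS leq_eqVlt => /orP[/eqP pe|//].
    by rewrite -pe pp in pK.
  by rewrite ler_wpM2r ?powR_ge0// ler_weXn2l// leq_min geq_minr andbT geq_min leqnSn.
have [u0 v0] : (0 < n`_K)%N /\ (0 < n`_K^')%N by rewrite !part_gt0.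
rewrite -{1 2}(partnC K n0).
have /(IH _ v0) Hv : forall p : nat, prime p -> (p %| n`_K^')%N -> (p < K)%N.
  move=> p pp pn; have := hn p pp (dvdn_trans pn (dvdn_part _ _)).
  rewrite ltnS leq_eqVlt => /orP[/eqP pe|//].
  have := part_pnat K^' n => /pnatP -/(_ v0 p pp pn).
  by rewrite pe !inE eqxx.
have Hu : (size (divisors n`_K))%:R <= c ^+ (K < P0)%N * (n`_K)%N%:R `^ d.
  rewrite p_part; case: ltnP => h.
    rewrite expr1; apply: le_trans (small _ _ (prime_gt1 pK)).
    by rewrite ler_nat size_divisors_pfactor.
  rewrite expr0 mul1r; apply: le_trans (large _ _ h (prime_gt1 pK)).
  by rewrite ler_nat size_divisors_pfactor.
apply: le_trans (_ : (size (divisors n`_K) * size (divisors n`_K^'))%:R <= _).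
  by rewrite ler_nat size_divisorsM.
rewrite !natrM; apply: le_trans (ler_pM _ _ Hu Hv) _ => //.
rewrite powRM// mulrACA -exprD.
have -> : ((K < P0) + minn K P0 = minn K.+1 P0)%N by lia.
by [].
Qed.

(** By telescoping: d x^(-1-d) <= (x - 1)^(-d) - x^(-d), which is the
    inequality exp(u) >= 1 + u at u = - d ln(1 - 1/x) >= d / x. *)
Lemma zeta_partial_sum_le d T : 0 < d ->
  \sum_(i < T) i.+1%:R `^ (- (1 + d)) <= 1 + d^-1 :> R.
Proof.
move=> d0; suff H : \sum_(i < T) i.+1%:R `^ (- (1 + d)) <=
     1 + d^-1 * (1 - T%:R `^ (- d)) :> R \/ T = 0%N.
  case: H => [H|->]; last by rewrite big_ord0 addr_ge0// invr_ge0 ltW.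
  apply: le_trans H _; rewrite lerD2l ler_piMr ?invr_ge0 ?(ltW d0)//.
elim: T => [|[|T] IH]; [by right|left|left].
  by rewrite big_ord_recr big_ord0 /= !powR1 add0r subrr mulr0 addr0.
case: IH => // IH; rewrite big_ord_recr /=.
apply: le_trans (lerD IH (lexx _)) _.
rewrite -addrA lerD2l.
suff : d * T.+2%:R `^ (- (1 + d)) + T.+2%:R `^ (- d) <= T.+1%:R `^ (- d) :> R.
  move=> h; rewrite -(ler_pM2l d0) mulrDr !mulVKf ?gt_eqF//; lra.
set y : R := T.+2%:R; have y0 : 0 < y by rewrite ltr0n.
have y1 : 1 < y by rewrite ltr1n.
have -> : T.+1%:R = y * (1 - y^-1) :> R.
  by rewrite mulrBr mulfV ?gt_eqF// mulr1 /y -[T.+2]addn1 natrD addrK.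
have t0 : 0 < 1 - y^-1 by rewrite subr_gt0 invf_lt1.
rewrite opprD powRD; last by apply/implyP => _; rewrite gt_eqF.
rewrite powR_inv1 ?(ltW y0)// powRM ?(ltW y0) ?(ltW t0)//.
rewrite -[X in _ + X]mul1r mulrA -mulrDl mulrC ler_wpM2l ?powR_ge0//.
rewrite /powR gt_eqF//; apply: le_trans (expR_ge1Dx _).
rewrite addrC lerD2l mulNr -mulrN ler_pM2l//.
have := le_ln1Dx (_ : - 1 < - y^-1); rewrite ltrN2 invf_lt1// => /(_ y1).
by rewrite lerNr.
Qed.

(** Sum over g = gcd(n, A) and r = n / g: then lcm(n, A) = A r, so that the
    terms with a given g add up to at most A^(w - a) times a convergent sum
    over r, and there are tau(A) values of g. *)
Lemma lcm_sum_le (w : nat) (a d : R) : 0 < d -> w%:R + 1 + d <= a ->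
  exists2 C : R, 0 < C & forall T A, (0 < A)%N ->
    \sum_(i < T) i.+1%:R ^+ w * (lcmn i.+1 A)%:R `^ (- a)
      <= C * A%:R `^ (w%:R - a + d).
Proof.
move=> d0 ad; have [C C1 HC] := size_divisors_le_powR d0.
exists (C * (1 + d^-1)) => [|T A A0].
  by rewrite mulr_gt0 ?(lt_le_trans _ C1)// ltr_wpDr ?invr_ge0// ltW.
set S := (X in _ <= X).
pose G (r : nat) : R := A%:R `^ (w%:R - a) * r.+1%:R `^ (- (1 + d)).
have step (i : 'I_T) : i.+1%:R ^+ w * (lcmn i.+1 A)%:R `^ (- a) <=
   \sum_(g <- divisors A) \sum_(r < T) (if (g * r.+1 == i.+1)%N then G r else 0).
  set g := gcdn i.+1 A; have g0 : (0 < g)%N by rewrite gcdn_gt0.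
  have gA : g \in divisors A by rewrite -dvdn_divisors// dvdn_gcdr.
  have rg : (0 < i.+1 %/ g)%N by rewrite divn_gt0// dvdn_leq// dvdn_gcdl.
  have rT : ((i.+1 %/ g).-1 < T)%N.
    rewrite prednK//; apply: leq_trans (leq_div _ _) _; exact: ltn_ord.
  rewrite (big_rem g)//= (bigD1 (Ordinal rT))//= prednK//.
  rewrite mulnC divnK ?dvdn_gcdl// eqxx -addrA.
  apply: ler_wpDr.
    rewrite addr_ge0// ?sumr_ge0// => [j _|j _].
      by case: ifP => // _; rewrite mulr_ge0 ?powR_ge0.
    rewrite sumr_ge0// => k _.
    by case: ifP => // _; rewrite mulr_ge0 ?powR_ge0.
  rewrite /G prednK//; set r := (i.+1 %/ g)%N.
  have -> : lcmn i.+1 A = (A * r)%N by rewrite /lcmn mulnC muln_divA ?dvdn_gcdl.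
  have -> : i.+1%:R = g%:R * r%:R :> R by rewrite -natrM mulnC divnK ?dvdn_gcdl.
  have gAl : (g <= A)%N by rewrite dvdn_leq// dvdn_gcdr.
  have r1 : 1 <= r%:R :> R by rewrite ler1n.
  rewrite natrM powRM// exprMn mulrACA.
  rewrite -!powR_mulrn//.
  have rp : 0 < r%:R :> R by rewrite ltr0n.
  have Ap : 0 < A%:R :> R by rewrite ltr0n.
  rewrite -[X in _ * X <= _]powRD; last by apply/implyP => _; rewrite gt_eqF.
  apply: ler_pM; rewrite ?mulr_ge0 ?powR_ge0//; last by rewrite ler_powR//; lra.
  rewrite powRD; last by apply/implyP => _; rewrite gt_eqF.
  rewrite ler_wpM2r ?powR_ge0// ge0_ler_powR ?nnegrE ?ler_nat//.
apply: le_trans (ler_sum _ (fun i _ => step i)) _.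
rewrite exchange_big /=.
apply: le_trans (_ : \sum_(g <- divisors A) A%:R `^ (w%:R - a) * (1 + d^-1) <= _); last first.
  rewrite big_const_seq count_predT iter_addr_0 -[leLHS]mulr_natr /S.
  rewrite [A%:R `^ (_ + d)]powRD; last by apply/implyP => _; rewrite gt_eqF ?ltr0n.
  rewrite [leRHS](_ : _ = A%:R `^ (w%:R - a) * (1 + d^-1) * (C * A%:R `^ d)); last by ring.
  by rewrite ler_wpM2l ?HC// mulr_ge0 ?powR_ge0// addr_ge0// invr_ge0 ltW.
rewrite big_seq [leRHS]big_seq; apply: ler_sum => g gA.
rewrite exchange_big /=.
apply: le_trans (_ : \sum_(r < T) G r <= _); last first.
  by rewrite -mulr_sumr ler_wpM2l ?powR_ge0// zeta_partial_sum_le.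
have g0 : (0 < g)%N by move: gA; rewrite -dvdn_divisors// => /dvdn_gt0; apply.
apply: ler_sum => r _; rewrite -big_mkcond /=.
have [/existsP[i0 /eqP hi0]|/existsPn ne] := boolP [exists i : 'I_T, g * r.+1 == i.+1]%N.
  rewrite (big_pred1 i0) // => i /=; rewrite hi0 eqSS eq_sym.
  by apply/eqP/eqP => [/ord_inj//|->].
rewrite big_pred0 ?mulr_ge0 ?powR_ge0// => i; exact/negbTE/ne.
Qed.

(** Here n_ij stands for the pivot at the pair ij, with the exponent of its
    colexicographic rank, and the four powers with exponent -s are lower bounds
    for the pivots of X(N).  The variables are eliminated in the order 01, 02,
    03 and then 12, 13, 23; for the second pivot of X the bound n_13 alone is
    kept.  With s = 4 + 2d each divisor bound costs d, and what remains is the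
    sum of n_23^(5 - (2 + d) - 4) = n_23^(-1-d). *)
Lemma pivot_sum_bounded (s : R) : 4 < s -> exists C : R, forall T : nat,
  \sum_(n23 < T) n23.+1%:R ^+ 5 *
  (\sum_(n13 < T) n13.+1%:R ^+ 4 * n13.+1%:R `^ (- s) *
   ((\sum_(n03 < T) n03.+1%:R ^+ 3 *
        (lcmn n03.+1 (lcmn n13.+1 n23.+1))%:R `^ (- s) *
     (\sum_(n02 < T) n02.+1%:R *
      (\sum_(n01 < T) (lcmn n01.+1 (lcmn n02.+1 n03.+1))%:R `^ (- s)))) *
    (\sum_(n12 < T) n12.+1%:R ^+ 2 * (lcmn n12.+1 n23.+1)%:R `^ (- s)))) <= C.
Proof.
move=> s4; pose d := (s - 4) / 2; have d0 : 0 < d by rewrite /d; lra.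
have sE : s = 4 + d + d by rewrite /d; lra.
have [|C1 p1 H1] := @lcm_sum_le 0 s d d0; first by lra.
have [|C2 p2 H2] := @lcm_sum_le 1 (s - d) d d0; first by lra.
have [|C3 p3 H3] := @lcm_sum_le 0 s d d0; first by lra.
have [|C4 p4 H4] := @lcm_sum_le 2 s d d0; first by lra.
have [|C5 p5 H5] := @lcm_sum_le 0 (s - d) d d0; first by lra.
exists (C1 * C2 * C3 * C4 * C5 * (1 + d^-1)) => T.
have pw (x : nat) (a b : R) : x.+1%:R `^ (a + b) = x.+1%:R `^ a * x.+1%:R `^ b :> R.
  by rewrite powRD//; apply/implyP => _; rewrite gt_eqF// ltr0n.
have px (x k : nat) : x.+1%:R ^+ k = x.+1%:R `^ k%:R :> R by rewrite powR_mulrn.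
have s1 n02 n03 : \sum_(n01 < T) (lcmn n01.+1 (lcmn n02.+1 n03.+1))%:R `^ (- s) <=
    C1 * (lcmn n02.+1 n03.+1)%:R `^ (- (s - d)).
  have := H1 T (lcmn n02.+1 n03.+1); rewrite lcmn_gt0 => /(_ isT).
  by under eq_bigr do rewrite expr0 mul1r; rewrite add0r opprB addrC.
have s2 n03 : \sum_(n02 < T) n02.+1%:R *
      (\sum_(n01 < T) (lcmn n01.+1 (lcmn n02.+1 n03.+1))%:R `^ (- s)) <=
    C1 * C2 * n03.+1%:R `^ (- 3).
  apply: le_trans (_ : \sum_(n02 < T) C1 * (n02.+1%:R ^+ 1 *
     (lcmn n02.+1 n03.+1)%:R `^ (- (s - d))) <= _).
    by apply: ler_sum => n02 _; rewrite mulrCA expr1 ler_wpM2l.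
  rewrite -mulr_sumr -mulrA ler_pM2l//; apply: le_trans (H2 T n03.+1 isT) _.
  rewrite ler_pM2l// ler_powR ?ler1n//; lra.
have s3 n13 n23 : \sum_(n03 < T) n03.+1%:R ^+ 3 *
        (lcmn n03.+1 (lcmn n13.+1 n23.+1))%:R `^ (- s) *
     (\sum_(n02 < T) n02.+1%:R *
      (\sum_(n01 < T) (lcmn n01.+1 (lcmn n02.+1 n03.+1))%:R `^ (- s))) <=
    C1 * C2 * C3 * (lcmn n13.+1 n23.+1)%:R `^ (- (s - d)).
  apply: le_trans (_ : \sum_(n03 < T) C1 * C2 * (n03.+1%:R ^+ 0 *
     (lcmn n03.+1 (lcmn n13.+1 n23.+1))%:R `^ (- s)) <= _).
    apply: ler_sum => n03 _; apply: le_trans (ler_wpM2l _ (s2 n03)) _.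
      by rewrite mulr_ge0 ?powR_ge0 ?exprn_ge0.
    rewrite expr0 mul1r mulrCA ler_pM2l; last exact: mulr_gt0.
    rewrite mulrAC px -pw subrr powRr0 mul1r; exact: lexx.
  rewrite -mulr_sumr -[leRHS]mulrA ler_pM2l ?mulr_gt0//.
  have := H3 T (lcmn n13.+1 n23.+1); rewrite lcmn_gt0 => /(_ isT).
  by rewrite add0r opprB [d - s]addrC.
have s4' n23 : \sum_(n12 < T) n12.+1%:R ^+ 2 * (lcmn n12.+1 n23.+1)%:R `^ (- s) <=
    C4 * n23.+1%:R `^ (- (2 + d)).
  apply: le_trans (H4 T n23.+1 isT) _; rewrite ler_pM2l// ler_powR ?ler1n//; lra.
have s5 (n23 : 'I_T) : \sum_(n13 < T) (lcmn n13.+1 n23.+1)%:R `^ (- (s - d)) <=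
    C5 * n23.+1%:R `^ (- 4).
  have := H5 T n23.+1 isT; under eq_bigr do rewrite expr0 mul1r.
  move=> h; apply: le_trans h _; rewrite ler_pM2l// ler_powR ?ler1n//; lra.
have g1 n13 n23 : 0 <= \sum_(n03 < T) n03.+1%:R ^+ 3 *
        (lcmn n03.+1 (lcmn n13.+1 n23.+1))%:R `^ (- s) *
     (\sum_(n02 < T) n02.+1%:R *
      (\sum_(n01 < T) (lcmn n01.+1 (lcmn n02.+1 n03.+1))%:R `^ (- s))).
  apply: sumr_ge0 => i _; rewrite !mulr_ge0 ?powR_ge0 ?exprn_ge0//.
  apply: sumr_ge0 => j _; rewrite mulr_ge0//.
  by apply: sumr_ge0 => k _; rewrite powR_ge0.
have g2 n23 : 0 <= \sum_(n12 < T) n12.+1%:R ^+ 2 * (lcmn n12.+1 n23.+1)%:R `^ (- s).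
  by apply: sumr_ge0 => i _; rewrite mulr_ge0 ?powR_ge0 ?exprn_ge0.
apply: le_trans (_ : \sum_(n23 < T) C1 * C2 * C3 * C4 * C5 * (n23.+1%:R `^ (- (1 + d))) <= _).
  apply: ler_sum => n23 _.
  apply: le_trans (_ : n23.+1%:R ^+ 5 * (\sum_(n13 < T)
     (C1 * C2 * C3 * C4 * n23.+1%:R `^ (- (2 + d))) *
      (lcmn n13.+1 n23.+1)%:R `^ (- (s - d))) <= _).
    rewrite ler_wpM2l ?exprn_ge0//; apply: ler_sum => n13 _.
    apply: le_trans (_ : 1 * (C1 * C2 * C3 * (lcmn n13.+1 n23.+1)%:R `^ (- (s - d)) *
       (C4 * n23.+1%:R `^ (- (2 + d)))) <= _).
      apply: ler_pM; rewrite ?mulr_ge0 ?powR_ge0 ?exprn_ge0 ?g1 ?g2//.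
        rewrite px -pw -[leRHS](powRr0 (n13.+1%:R : R)) ler_powR ?ler1n//; lra.
      by apply: ler_pM; rewrite ?g1 ?g2 ?s3 ?s4'.
    by rewrite mul1r le_eqVlt; apply/orP; left; apply/eqP; ring.
  rewrite -mulr_sumr; apply: le_trans (ler_wpM2l _ (ler_wpM2l _ (s5 n23))) _.
  - by rewrite exprn_ge0.
  - by rewrite !mulr_ge0 ?powR_ge0// ltW.
  rewrite px [leLHS](_ : _ = C1 * C2 * C3 * C4 * C5 * (n23.+1%:R `^ 5%:R *
    (n23.+1%:R `^ (- (2 + d)) * n23.+1%:R `^ (- 4)))); last by ring.
  rewrite ler_pM2l ?mulr_gt0// -!pw ler_powR ?ler1n//; lra.
rewrite -mulr_sumr ler_pM2l ?mulr_gt0//; exact: zeta_partial_sum_le.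
Qed.

End DivisorBound.

(** * Hermite normal form of lattices in Z^r *)
Section HermiteNormalForm.
Local Open Scope ring_scope.
Local Open Scope classical_set_scope.
Variable r : nat.
Implicit Types (L : set 'rV[int]_r) (B : 'M[int]_r) (u v : 'rV[int]_r).

Definition lattice L := L 0 /\ forall u v, L u -> L v -> L (u - v).

(** Full rank in the form that pigeonhole arguments produce. *)
Definition full_rank L := forall v, exists2 k : nat, (0 < k)%N & L (v *+ k).

Definition row_lattice B : set 'rV[int]_r := [set u *m B | u in setT].

Definition triangular B :=
  (forall i, 0 < B i i) /\ forall i j : 'I_r, (j < i)%N -> B i j = 0.

Definition hermite B :=
  triangular B /\ forall i j : 'I_r, (i < j)%N -> 0 <= B i j < B j j.

Lemma latticeD L u v : lattice L -> L u -> L v -> L (u + v).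
Proof.
move=> [L0 LB] Lu Lv; rewrite -[v]opprK; apply: (LB) => //.
by rewrite -sub0r; apply: LB.
Qed.

Lemma latticeZ L (z : int) v : lattice L -> L v -> L (z *: v).
Proof.
move=> lL Lv; have [L0 LB] := lL.
have LN (n : nat) : L (n%:Z *: v).
  elim: n => [|n IH]; first by rewrite scale0r.
  by rewrite intS scalerDl scale1r; apply: latticeD.
by case: z => n //; rewrite NegzE scaleNr -sub0r; apply: LB.
Qed.

Lemma lattice_row_lattice B : lattice (row_lattice B).
Proof.
split; first by exists 0 => //; rewrite mul0mx.
by move=> _ _ [u _ <-] [v _ <-]; exists (u - v) => //; rewrite mulmxBl.
Qed.

Lemma row_lattice_sub L B : lattice L -> (forall i, L (row i B)) ->
  row_lattice B `<=` L.
Proof.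
move=> lL LB _ [u _ <-]; rewrite mulmx_sum_row.
elim/big_ind: _ => [|x y|i _]; [by case: lL|exact: latticeD|exact: latticeZ].
Qed.

Lemma triangular_lead B u (i : 'I_r) : triangular B ->
  (forall j : 'I_r, (j < i)%N -> u 0 j = 0) -> (u *m B) 0 i = u 0 i * B i i.
Proof.
move=> [_ BT] u0; rewrite mxE (bigD1 i)//= big1 ?addr0// => j ji.
case: (ltngtP j i) => [/u0->|/BT->|/ord_inj ij]; rewrite ?mul0r ?mulr0//.
by rewrite ij eqxx in ji.
Qed.

(** The coefficients of u vanish one after the other, as the pivots are nonzero.
    Divisibility relations between pivots are found in this way. *)
Lemma triangular_lead0 B u (i : 'I_r) : triangular B ->
  (forall j : 'I_r, (j < i)%N -> (u *m B) 0 j = 0) ->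
  (u *m B) 0 i = u 0 i * B i i.
Proof.
move=> BT v0; apply: triangular_lead => //.
suff H (m : nat) (j : 'I_r) : (j < m)%N -> (m <= i)%N -> u 0 j = 0.
  by move=> j ji; exact: (H i).
elim: m j => // m IH j; rewrite ltnS leq_eqVlt => /orP[/eqP jm|jm] mi; last first.
  by apply: IH jm _; exact: ltnW.
have uj : forall k : 'I_r, (k < j)%N -> u 0 k = 0.
  by move=> k kj; apply: IH; [rewrite -jm|exact: ltnW].
have := triangular_lead BT uj; rewrite v0 ?jm//.
by move/esym/eqP; rewrite mulf_eq0 [B j j == 0]gt_eqF ?orbF ?BT.1// => /eqP.
Qed.

(** So the box with sides the pivots meets each coset of the row lattice at
    most once, which bounds indices from below. *)
Lemma triangular_small B v : triangular B -> row_lattice B v ->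
  (forall i, `|v 0 i| < B i i) -> v = 0.
Proof.
move=> BT [u _ <-] small; apply/rowP => i; rewrite [RHS]mxE.
suff H (m : nat) (j : 'I_r) : (j < m)%N -> (u *m B) 0 j = 0 by exact: (H i.+1).
elim: m j => // m IH j; rewrite ltnS leq_eqVlt => /orP[/eqP jm|]; last exact: IH.
have uj : (u *m B) 0 j = u 0 j * B j j.
  by apply: triangular_lead0 => // k kj; apply: IH; rewrite -jm.
have := small j; rewrite uj normrM (gtr0_norm (BT.1 j)) gtr_pMl ?BT.1// => u1.
have -> : u 0 j = 0 by lia.
by rewrite mul0r.
Qed.

(** Reduction from column m onwards: the coordinates are brought into the box
    from left to right, as the row of index i does not disturb earlier columns. *)
Lemma triangular_reduce B (m : nat) v : triangular B -> exists2 u : 'rV[int]_r,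
  (forall j : 'I_r, (j < m)%N -> u 0 j = 0) &
  forall j : 'I_r, (m <= j)%N -> 0 <= (v - u *m B) 0 j < B j j.
Proof.
move=> BT; have [k mk] := ubnP (r - m).
elim: k m mk v => // k IH m mk v.
have [rm|mr] := leqP r m.
  exists 0 => [j _|j]; first by rewrite mxE.
  by move/(leq_trans rm); rewrite leqNgt ltn_ord.
pose i := Ordinal mr; pose q := (v 0%R i %/ B i i)%Z.
have [|u u0 ub] := IH m.+1 _ (v - q *: row i B); first by lia.
exists (u + q *: delta_mx 0 i) => [j jm|j].
  rewrite !mxE u0 ?(ltn_trans jm)//= add0r.
  by rewrite (_ : j == i = false) ?andbF ?mulr0//; apply/eqP => ji; rewrite ji ltnn in jm.
rewrite mulmxDl -scalemxAl -rowE opprD addrA addrAC.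
rewrite leq_eqVlt => /orP[/eqP mj|/ub//].
have -> : j = i by apply: val_inj.
rewrite [X in 0 <= X < _](_ : _ = (v 0%R i %% B i i)%Z).
  by rewrite modz_ge0 ?gt_eqF ?BT.1//= ltz_pmod ?BT.1.
have uBi : (u *m B) 0 i = 0.
  rewrite triangular_lead// ?u0 ?mul0r// => l li; apply: u0; exact: ltnW.
by rewrite mxE [X in _ + X]mxE uBi subr0 !mxE /modz.
Qed.

(** The pivot is the least positive i-th coordinate among the vectors of L that
    vanish before i; Euclidean division shows that it divides all of them. *)
Lemma pivot_exists L (i : 'I_r) : lattice L -> full_rank L -> exists b : 'rV[int]_r,
  [/\ L b, 0 < b 0 i, forall j : 'I_r, (j < i)%N -> b 0 j = 0 &
   forall v, L v -> (forall j : 'I_r, (j < i)%N -> v 0 j = 0) ->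
     (b 0%R i %| v 0%R i)%Z].
Proof.
move=> lL fL.
pose P (k : nat) := `[< (0 < k)%N /\ exists b, [/\ L b, b 0 i = k%:Z &
   forall j : 'I_r, (j < i)%N -> b 0 j = 0] >].
have exP : exists k, P k.
  have [k k0 Lk] := fL (delta_mx 0 i); exists k; apply/asboolP; split=> //.
  exists (delta_mx 0 i *+ k); split=> //.
    by rewrite -scaler_nat !mxE !eqxx mulr1 natz.
  move=> j ji; rewrite -scaler_nat !mxE (_ : j == i = false) ?andbF ?mulr0//.
  by apply/eqP => e; rewrite e ltnn in ji.
case: (ex_minnP exP) => p /asboolP[p0 [b [Lb bi b0]]] pmin.
exists b; split=> //; first by rewrite bi.
move=> v Lv v0; rewrite bi; set q := (v 0%R i %/ p)%Z.
have lw : L (v - q *: b) by apply: lL.2 => //; apply: latticeZ.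
have wi : (v - q *: b) 0 i = (v 0%R i %% p)%Z by rewrite !mxE bi /modz.
apply/dvdz_mod0P; have /ger0_norm wE : 0 <= (v 0%R i %% p)%Z.
  by rewrite modz_ge0// -lt0n.
apply/eqP; apply: contraT => w0.
have : P `|(v 0%R i %% p)%Z|%N.
  apply/asboolP; split; first by rewrite absz_gt0.
  exists (v - q *: b); split=> //; first by rewrite wi abszE wE.
  by move=> j ji; rewrite !mxE v0// b0// mulr0 subr0.
move=> /pmin; rewrite -lez_nat abszE wE leNgt ltz_pmod//.
Qed.

(** Vectors realizing the pivots are made into a triangular matrix, and the
    entries to the right of each pivot are then reduced by the later rows. *)
Lemma hermite_exists L : lattice L -> full_rank L ->
  exists2 B, hermite B & L = row_lattice B.
Proof.
move=> lL fL; have [b Hb] := boolp.choice (fun i => pivot_exists i lL fL).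
pose B0 : 'M[int]_r := \matrix_i b i.
have B0T : triangular B0.
  split=> [i|i j ji]; rewrite mxE; have [_ h h0 _] := Hb i => //; exact: h0.
have reduced (i : 'I_r) : exists u : 'rV[int]_r,
   (forall j : 'I_r, (j < i.+1)%N -> u 0 j = 0) /\
   forall j : 'I_r, (i.+1 <= j)%N -> 0 <= (b i - u *m B0) 0 j < B0 j j.
  by have [u] := @triangular_reduce B0 i.+1 (b i) B0T; exists u.
have [w Hw] := boolp.choice reduced.
pose B : 'M[int]_r := \matrix_i (b i - w i *m B0).
have wB0 (i j : 'I_r) : (j <= i)%N -> (w i *m B0) 0 j = 0.
  move=> ji; have [w0 _] := Hw i.
  by rewrite triangular_lead// ?w0 ?mul0r// => k kj; apply/w0/(leq_trans kj)/leqW.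
have BE (i j : 'I_r) : (j <= i)%N -> B i j = b i 0 j.
  by move=> ji; rewrite /B mxE mxE [X in _ + X]mxE wB0// subr0.
have BT : triangular B.
  split=> [i|i j ji]; rewrite BE// ?(ltnW ji)//; have [_ ? h _] := Hb i => //.
  exact: h.
have LB i : L (row i B).
  rewrite rowK; apply: lL.2; first by have [] := Hb i.
  apply: (row_lattice_sub (B := B0)) => //; last by exists (w i).
  by move=> k; rewrite rowK; have [] := Hb k.
exists B.
  split=> // i j ij; rewrite [B j j]BE// mxE.
  by have [_ /(_ j ij)] := Hw i; rewrite [B0 j j]mxE.
apply/seteqP; split; last exact: row_lattice_sub.
suff H (m : nat) v : L v -> (forall j : 'I_r, (j < r - m)%N -> v 0 j = 0) ->
    row_lattice B v.
  by move=> v Lv; apply: (H r) => // j; rewrite subnn.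
elim: m v => [|m IH] v Lv v0.
  have -> : v = 0 by apply/rowP => j; rewrite [RHS]mxE v0// subn0.
  by case: (lattice_row_lattice B).
have [mr|mr] := leqP r m.
  by apply: IH => // j ?; apply: v0; lia.
have ir : (r - m.+1 < r)%N by lia.
pose i := Ordinal ir; have [_ bi0 b0 /(_ v Lv v0)/dvdzP[q vi]] := Hb i.
have -> : v = v - q *: row i B + q *: row i B by rewrite subrK.
apply: (latticeD (lattice_row_lattice B)); last first.
  by exists (q *: delta_mx 0 i) => //; rewrite -scalemxAl -rowE.
apply: IH; first by apply: lL.2 => //; apply: latticeZ.
move=> j jm; have ji : (j <= i)%N by rewrite /=; lia.
rewrite (_ : (v - _) 0 j = v 0 j - q * B i j); last by rewrite !mxE.
rewrite BE//; move: ji; rewrite leq_eqVlt => /orP[/eqP/ord_inj->|ji].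
  by rewrite vi subrr.
by rewrite v0// b0// mulr0 subr0.
Qed.

End HermiteNormalForm.

(** * Normal words in a class-two group with four generators *)
Section ClassTwoCollection.
Local Open Scope group_scope.
Variable G : groupType.
Implicit Types (x y z c g : G) (a b : int).

Definition zpow g a : G :=
  match a with Posz n => g ^+ n | Negz n => g ^- n.+1 end.

(** In these terms collection in a class-two group is bilinearity of the
    commutator c in x and y ([swapsM], [swaps_zpow2]). *)
Definition swaps y x c : Prop := y * x = x * y * c /\ forall g, c * g = g * c.

Lemma zpow0 g : zpow g 0%R = 1. Proof. by []. Qed.

Lemma zpow1 g : zpow g 1%R = g. Proof. by []. Qed.

Lemma zpowS g a : zpow g (a + 1)%R = zpow g a * g.
Proof.
case: a => [n|[|n]]; first by rewrite -PoszD addn1 /= expgSr.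
  by rewrite /= expg1 mulVg.
rewrite (_ : (Negz n.+1 + 1)%R = Negz n); last by lia.
by rewrite /= [g ^+ n.+2]expgS invgM mulgVK.
Qed.

Lemma zpowD g a b : zpow g (a + b)%R = zpow g a * zpow g b.
Proof.
have zP a' : zpow g (a' - 1)%R = zpow g a' * g^-1.
  by rewrite -[in RHS](subrK 1%R a') zpowS mulgK.
elim/int_rect: b => [|n IH|n IH]; first by rewrite addr0 zpow0 mulg1.
  by rewrite intS [(1 + _)%R]addrC addrA !zpowS IH mulgA.
rewrite (_ : (- n.+1%:Z = - n%:Z - 1)%R); last by lia.
by rewrite addrA !zP IH mulgA.
Qed.

Lemma zpowN g a : zpow g (- a)%R = (zpow g a)^-1.
Proof. by apply/esym/mulg1_eq; rewrite -zpowD subrr. Qed.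

Lemma zpow_central c a : (forall g, c * g = g * c) ->
  forall g, zpow c a * g = g * zpow c a.
Proof.
move=> cC g; apply/esym; case: a => n /=; first exact: commuteX.
exact/commuteV/commuteX.
Qed.

Lemma swaps_sym y x c : swaps y x c -> swaps x y c^-1.
Proof.
case=> yx cC; split=> [|g]; first by rewrite yx mulgK.
by apply/esym/commuteV/esym/cC.
Qed.

Lemma swapsM y x x' c c' : swaps y x c -> swaps y x' c' ->
  swaps y (x * x') (c * c').
Proof.
move=> [yx cC] [yx' cC']; split=> [|g].
  rewrite [LHS]mulgA yx -[LHS]mulgA (cC x') [LHS]mulgA -[x * y * x']mulgA yx'.
  by rewrite !mulgA -[_ * c' * c]mulgA -(cC c') !mulgA.
by rewrite -mulgA cC' [LHS]mulgA (cC g) [RHS]mulgA.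
Qed.

Lemma swaps1 y : swaps y 1 1.
Proof. by split=> [|g]; rewrite !mulg1 ?mul1g. Qed.

Lemma swapsV y x c : swaps y x c -> swaps y x^-1 c^-1.
Proof.
case=> yx cC; split=> [|g]; last by apply/esym/commuteV/esym/cC.
apply: (mulgI x); apply: (mulIg x); apply: (mulIg c).
have -> : x * (x^-1 * y * c^-1) * x * c = y * x.
  rewrite !mulgA mulgV mul1g -!mulgA [c^-1 * _]mulgA.
  by rewrite -[c^-1 * x * c]mulgA -cC mulKg.
by rewrite mulgA mulgVK yx.
Qed.

Lemma swaps_zpow y x c a : swaps y x c -> swaps y (zpow x a) (zpow c a).
Proof.
move=> s; have sn n : swaps y (x ^+ n) (c ^+ n).
  elim: n => [|n IH]; first by rewrite !expg0; exact: swaps1.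
  by rewrite !expgS; apply: swapsM.
by case: a => n /=; [exact: sn | exact/swapsV/sn].
Qed.

Lemma zpowV g a : zpow g^-1 a = (zpow g a)^-1.
Proof. by case: a => n /=; rewrite expVgn. Qed.

Lemma swaps_zpow2 y x c a b : swaps y x c ->
  swaps (zpow y a) (zpow x b) (zpow c (a * b)%R).
Proof.
move=> s; have cC := s.2.
have /swaps_sym := swaps_zpow a (swaps_sym s).
rewrite zpowV invgK => /(swaps_zpow b).
suff -> : zpow (zpow c a) b = zpow c (a * b)%R by [].
have cm n : commute (zpow c a) (zpow c (a * n)%R) by exact: zpow_central.
elim/int_rect: b => [|n IH|n IH]; first by rewrite mulr0.
  by rewrite intS mulrDr mulr1 !zpowD IH.
rewrite (_ : (- n.+1%:Z = - n%:Z - 1)%R); last by lia.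
by rewrite mulrDr !zpowD IH mulrN1 !zpowN zpow1.
Qed.

End ClassTwoCollection.

(** The pairs i < j of vertices among 0, .., 3, in colexicographic order
    01, 02, 12, 03, 13, 23.  This order makes the leading coordinate of a wedge
    product predictable, and it is also the order in which commutators appear
    when words are collected. *)
Definition edge_lo (e : 'I_6) : 'I_4 :=
  tnth [tuple of [:: @Ordinal 4 0 isT; @Ordinal 4 0 isT; @Ordinal 4 1 isT;
                     @Ordinal 4 0 isT; @Ordinal 4 1 isT; @Ordinal 4 2 isT]] e.

Definition edge_hi (e : 'I_6) : 'I_4 :=
  tnth [tuple of [:: @Ordinal 4 1 isT; @Ordinal 4 2 isT; @Ordinal 4 2 isT;
                     @Ordinal 4 3 isT; @Ordinal 4 3 isT; @Ordinal 4 3 isT]] e.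

(** The commutators created when x^a x^b is collected to x^(a + b): each of the
    b_i factors x_i passes each of the a_j factors x_j with j > i. *)
Definition cocycle (a b : 'rV[int]_4) : 'rV[int]_6 :=
  (\row_e (a ord0 (edge_hi e) * b ord0 (edge_lo e)))%R.

Section NormalWords.
Local Open Scope group_scope.
Variables (G : groupType) (x : 'I_4 -> G).
Implicit Types (a b : 'rV[int]_4) (c d : 'rV[int]_6) (g : G).
Hypothesis x_gen : forall H : set G, is_subgroup H -> (forall i, H (x i)) ->
  forall g, H g.
Hypothesis comm_central : forall a b g : G, [~ a, b] * g = g * [~ a, b].

Definition edge_comm (e : 'I_6) : G := [~ x (edge_hi e), x (edge_lo e)].

Definition gen_word (a : 'rV[int]_4) : G := \prod_(i < 4) zpow (x i) (a ord0 i).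

Definition comm_word (c : 'rV[int]_6) : G :=
  \prod_(e < 6) zpow (edge_comm e) (c ord0 e).

Definition normal_word a c : G := gen_word a * comm_word c.

Lemma comm_word_central c g : comm_word c * g = g * comm_word c.
Proof.
rewrite /comm_word; elim/big_ind: _ => [|u v hu hv|e _].
- by rewrite mul1g mulg1.
- by rewrite -mulgA hv mulgA hu mulgA.
- by apply: zpow_central => h; exact: comm_central.
Qed.

Lemma comm_wordD c d : comm_word (c + d)%R = comm_word c * comm_word d.
Proof.
rewrite /comm_word -prodgM_commute.
  by apply: eq_bigr => e _; rewrite mxE zpowD.
by move=> i j _ _; apply: zpow_central => g; exact: comm_central.
Qed.

Lemma gen_swaps (i j : 'I_4) (a b : int) : swaps (zpow (x j) a) (zpow (x i) b)
  (zpow [~ x j, x i] (a * b)%R).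
Proof. by apply: swaps_zpow2; split=> //; exact: commgC. Qed.

(** For j = 3, 2, 1 in turn, x_j^(a_j) is moved to the right past all the
    x_i^(b_i) with i < j. *)
Lemma gen_wordD a b :
  gen_word a * gen_word b = gen_word (a + b)%R * comm_word (cocycle a b).
Proof.
pose o k h := @Ordinal 4 k h.
pose A i := zpow (x i) (a ord0 i); pose B i := zpow (x i) (b ord0 i).
pose i0 := o 0%N isT; pose i1 := o 1%N isT; pose i2 := o 2%N isT; pose i3 := o 3%N isT.
have w4 (c : 'rV[int]_4) : gen_word c = zpow (x i0) (c ord0 i0) * zpow (x i1) (c ord0 i1) *
    zpow (x i2) (c ord0 i2) * zpow (x i3) (c ord0 i3).
  rewrite /gen_word !big_ord_recr big_ord0 /= mul1g.
  by congr (_ * _ * _ * _); congr (zpow (x _) (c _ _)); apply: val_inj.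
(* the commutators created by moving x_i^(b_i) past x_j^(a_j) *)
pose Z j i := zpow [~ x j, x i] (a ord0 j * b ord0 i)%R.
have zE : comm_word (cocycle a b) =
    Z i1 i0 * (Z i2 i0 * Z i2 i1) * (Z i3 i0 * Z i3 i1 * Z i3 i2).
  rewrite /comm_word !big_ord_recr big_ord0 /= mul1g /edge_comm !mxE !mulgA.
  by congr (_ * _ * _ * _ * _ * _).
have s1 := gen_swaps i0 i1 (a ord0 i1) (b ord0 i0).
have s2 := swapsM (gen_swaps i0 i2 (a ord0 i2) (b ord0 i0))
  (gen_swaps i1 i2 (a ord0 i2) (b ord0 i1)).
have s3 := swapsM (swapsM (gen_swaps i0 i3 (a ord0 i3) (b ord0 i0))
  (gen_swaps i1 i3 (a ord0 i3) (b ord0 i1))) (gen_swaps i2 i3 (a ord0 i3) (b ord0 i2)).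
rewrite zE !w4 !mxE !zpowD.
case: s1; rewrite -/(Z i1 i0) -/(A i1) -/(B i0); move: (Z i1 i0) => z1 e1 c1.
case: s2; rewrite -/(Z i2 i0) -/(Z i2 i1) -/(A i2) -/(B i0) -/(B i1).
move: (Z i2 i0 * Z i2 i1) => z2 e2 c2.
case: s3; rewrite -/(Z i3 i0) -/(Z i3 i1) -/(Z i3 i2) -/(A i3) -/(B i0) -/(B i1) -/(B i2).
move: (Z i3 i0 * Z i3 i1 * Z i3 i2) => z3 e3 c3.
rewrite -/(A i0) -/(A i1) -/(A i2) -/(A i3) -/(B i0) -/(B i1) -/(B i2) -/(B i3).
have -> : A i0 * A i1 * A i2 * A i3 * (B i0 * B i1 * B i2 * B i3) =
   A i0 * A i1 * A i2 * (A i3 * (B i0 * B i1 * B i2)) * B i3 by rewrite !mulgA.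
rewrite e3.
have -> : A i0 * A i1 * A i2 * (B i0 * B i1 * B i2 * A i3 * z3) * B i3 =
   A i0 * A i1 * (A i2 * (B i0 * B i1)) * B i2 * A i3 * (z3 * B i3) by rewrite !mulgA.
rewrite c3 e2.
have -> : A i0 * A i1 * (B i0 * B i1 * A i2 * z2) * B i2 * A i3 * (B i3 * z3) =
   A i0 * (A i1 * B i0) * B i1 * A i2 * (z2 * (B i2 * A i3 * B i3)) * z3
  by rewrite !mulgA.
rewrite c2 e1.
have -> : A i0 * (B i0 * A i1 * z1) * B i1 * A i2 * (B i2 * A i3 * B i3 * z2) * z3 =
   A i0 * B i0 * A i1 * (z1 * (B i1 * A i2 * B i2 * A i3 * B i3)) * z2 * z3
  by rewrite !mulgA.
by rewrite c1 !mulgA.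
Qed.

Lemma normal_wordM a c b d : normal_word a c * normal_word b d =
  normal_word (a + b)%R (c + d + cocycle a b)%R.
Proof.
rewrite /normal_word [(c + d + _)%R]addrC !comm_wordD [RHS]mulgA -gen_wordD.
by rewrite !mulgA -[gen_word a * _ * _]mulgA comm_word_central !mulgA.
Qed.

Lemma normal_word0 : normal_word 0%R 0%R = 1.
Proof.
apply: (mulgI (normal_word 0%R 0%R)); rewrite normal_wordM mulg1 !addr0.
by congr normal_word; apply/rowP => e; rewrite !mxE mul0r addr0.
Qed.

Lemma normal_word_surj g : exists a c, g = normal_word a c.
Proof.
apply: (x_gen (H := [set g | exists a c, g = normal_word a c])).
  apply/is_subgroupP; split=> [|u v [a [c ->]] [b [d ->]]|u [a [c ->]]].
  - by exists 0%R, 0%R; rewrite normal_word0.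
  - by rewrite normal_wordM; eexists _, _.
  - exists (- a)%R, (- c + cocycle a a)%R; apply: mulg1_eq.
    rewrite normal_wordM subrr addrA subrr add0r -normal_word0; congr normal_word.
    by apply/rowP => e; rewrite !mxE mulrN subrr.
move=> i; exists (delta_mx 0%R i), 0%R; rewrite /normal_word.
have -> : comm_word 0%R = 1.
  by rewrite /comm_word big1// => e _; rewrite mxE.
rewrite mulg1 /gen_word; case: i => -[|[|[|[|//]]]] ilt;
  rewrite !big_ord_recr big_ord0 /= !mxE /= !(zpow0, zpow1, mulg1, mul1g).
all: by rewrite expg1; congr (x _); exact: val_inj.
Qed.

End NormalWords.

(** * Normal subgroups of finite index as lattice data *)
Section Cosets.
Local Open Scope group_scope.
Local Open Scope classical_set_scope.
Variables (G : groupType) (H : set G) (n : nat).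
Hypotheses (Hsub : is_subgroup H) (Hn : has_index H n).

(** Finite index in usable form: cosets are labelled by 'I_n, which turns counting
    of cosets into injections and collisions of labels. *)
Lemma coset_label : exists f : G -> 'I_n, forall g h, f g = f h -> H (g^-1 * h).
Proof.
have [f [fI fi _]] := @card_set_bijP _ _ _ _ Hn.
have ff (g : G) : (f [set (g * h)%g | h in H] < n)%N by apply: fI; exists g.
exists (fun g => Ordinal (ff g)) => g h [/fi fgh].
have [H1 _ _] := (is_subgroupP H).1 Hsub.
have eq_cosets : [set g * k | k in H] = [set h * k | k in H].
  by apply: fgh; rewrite in_setE; [exists g | exists h].
have : [set h * k | k in H] h by exists 1; rewrite ?mulg1.
rewrite -eq_cosets; by case=> k Hk <-; rewrite mulKg.
Qed.

Lemma coset_separated_le (T : finType) (f : T -> G) :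
  (forall t u, H ((f t)^-1 * f u) -> t = u) -> (#|T| <= n)%N.
Proof.
move=> fH; have [l lP] := coset_label.
rewrite -[n]card_ord; apply: (leq_card (l \o f)) => t u /= /lP; exact: fH.
Qed.

Lemma coset_collision (f : nat -> G) : exists i j, (i < j)%N /\ H ((f i)^-1 * f j).
Proof.
apply: contrapT => nex.
suff : (#|'I_n.+1| <= n)%N by rewrite card_ord ltnn.
apply: (@coset_separated_le _ (f \o val)) => t u /= Htu.
case: (ltngtP t u) => [tu|ut|/ord_inj//]; case: nex.
  by exists t, u.
exists u, t; split=> //; have [_ _ HV] := (is_subgroupP H).1 Hsub.
by have := HV _ Htu; rewrite invgM invgK.
Qed.

End Cosets.

Definition wedge (a b : 'rV[int]_4) : 'rV[int]_6 := (cocycle a b - cocycle b a)%R.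

(** X(N): the vectors of Z^4 whose lifts to G are central modulo N. *)
Definition centralizing (N : set 'rV[int]_6) : set 'rV[int]_4 :=
  [set a | forall b, N (wedge a b)]%classic.

(** A Hermite basis of X(N), chosen as a function of the basis of N alone, so
    that M can be coded relative to it. *)
Definition central_basis (BN : 'M[int]_6) : 'M[int]_4 :=
  xget 0%R [set B | hermite B /\
    centralizing (row_lattice BN) = row_lattice B]%classic.

Lemma wedgeBl a b c : wedge (a - b)%R c = (wedge a c - wedge b c)%R.
Proof. by apply/rowP => e; rewrite !mxE; ring. Qed.

Lemma wedge0l c : wedge 0%R c = 0%R.
Proof. by apply/rowP => e; rewrite !mxE; ring. Qed.

Lemma lattice_centralizing N : lattice N -> lattice (centralizing N).
Proof.
move=> lN; split=> [b|a b Na Nb c]; first by rewrite wedge0l; case: lN.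
by rewrite wedgeBl; apply: lN.2; [exact: Na | exact: Nb].
Qed.

Lemma edge_lo_lt_hi (e : 'I_6) : (edge_lo e < edge_hi e)%N.
Proof. by case: e => -[|[|[|[|[|[|//]]]]]]. Qed.

Lemma edge_colex (e e' : 'I_6) : (e' < e)%N ->
  (edge_hi e' < edge_hi e)%N || (edge_hi e' == edge_hi e) && (edge_lo e' < edge_lo e)%N.
Proof.
by case: e => -[|[|[|[|[|[|//]]]]]] ?; case: e' => -[|[|[|[|[|[|//]]]]]].
Qed.

Section WedgeLeading.
Local Open Scope ring_scope.
Implicit Types (v : 'rV[int]_4) (e : 'I_6).

Lemma wedge_delta v k e : wedge v (delta_mx 0 k) 0 e =
  v 0 (edge_hi e) * (edge_lo e == k)%:R - (edge_hi e == k)%:R * v 0 (edge_lo e).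
Proof. by rewrite !mxE. Qed.

(** For e = ij with i < j: if v vanishes before i, then v /\ e_j vanishes before
    ij in colexicographic order and has the value - v_i there. *)
Lemma wedge_lead_lo v e : (forall j : 'I_4, (j < edge_lo e)%N -> v 0 j = 0) ->
  (forall e' : 'I_6, (e' < e)%N -> wedge v (delta_mx 0 (edge_hi e)) 0 e' = 0) /\
  wedge v (delta_mx 0 (edge_hi e)) 0 e = - v 0 (edge_lo e).
Proof.
move=> v0; split=> [e' /edge_colex ee|]; rewrite wedge_delta.
  have l' := edge_lo_lt_hi e'.
  have -> : (edge_lo e' == edge_hi e) = false.
    apply/eqP => h; move: ee l'; rewrite h; case/orP => [a b|/andP[/eqP -> _]].
      by have := ltn_trans a b; rewrite ltnn.
    by rewrite ltnn.
  rewrite mulr0 sub0r; case/orP: ee => [a|/andP[_ a]]; last by rewrite v0// mulr0 oppr0.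
  by rewrite (_ : _ == _ = false) ?mul0r ?oppr0//; apply/eqP => h; rewrite h ltnn in a.
rewrite eqxx (_ : _ == _ = false) ?mulr0 ?mul1r ?sub0r//.
by apply/eqP => h; have := edge_lo_lt_hi e; rewrite h ltnn.
Qed.

(** The companion for the other end of e = ij: v vanishes before j and is wedged
    with e_i. *)
Lemma wedge_lead_hi v e : (forall j : 'I_4, (j < edge_hi e)%N -> v 0 j = 0) ->
  (forall e' : 'I_6, (e' < e)%N -> wedge v (delta_mx 0 (edge_lo e)) 0 e' = 0) /\
  wedge v (delta_mx 0 (edge_lo e)) 0 e = v 0 (edge_hi e).
Proof.
move=> v0; have l := edge_lo_lt_hi e.
split=> [e' /edge_colex ee|]; rewrite wedge_delta; last first.
  by rewrite eqxx (v0 _ l) mulr0 subr0 mulr1.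
have l' := edge_lo_lt_hi e'; case/orP: ee => [a|/andP[/eqP h a]].
  by rewrite !v0 ?mul0r ?mulr0 ?subr0// (ltn_trans l').
rewrite (v0 (edge_lo e')) ?mulr0 ?subr0 -?h//.
by rewrite (_ : _ == _ = false) ?mulr0//; apply/eqP => k; rewrite k ltnn in a.
Qed.

End WedgeLeading.

Lemma dist_lt_nat (k l p : nat) : (k < p)%N -> (l < p)%N ->
  (`|Posz k - Posz l| < Posz p)%R.
Proof. lia. Qed.

Lemma triangularM r (A B : 'M[int]_r) : triangular A -> triangular B ->
  triangular (A *m B)%R /\ forall i, (A *m B)%R i i = (A i i * B i i)%R.
Proof.
move=> [Ap A0] [Bp B0].
have dE i : (A *m B)%R i i = (A i i * B i i)%R.
  rewrite mxE (bigD1 i)//= big1 ?addr0// => j ji.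
  case: (ltngtP j i) => [/A0->|/B0->|/ord_inj ij]; rewrite ?mul0r ?mulr0//.
  by rewrite ij eqxx in ji.
split=> //; split=> [i|i j ji]; first by rewrite dE mulr_gt0.
rewrite mxE big1// => k _; have [/A0->|ik] := ltnP k i; first by rewrite mul0r.
by rewrite B0 ?mulr0// (leq_trans ji).
Qed.

Lemma card_dffun_ord (I : finType) (p : I -> nat) :
  #|{dffun forall i, 'I_(p i)}| = \prod_i p i.
Proof.
rewrite card_dep_ffun /image_mem foldrE big_map big_enum /=.
by apply: eq_bigr => i _; rewrite card_ord.
Qed.

(** W stands for the normal words of a group: a surjection from Z^4 x Z^6 that is
    multiplicative up to the cocycle.  Subgroups are studied through their
    preimages in these coordinates. *)
Section NormalSubgroupStructure.
Local Open Scope group_scope.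
Local Open Scope classical_set_scope.
Variables (G : groupType) (W : 'rV[int]_4 -> 'rV[int]_6 -> G).
Hypothesis WM : forall a c b d,
  W a c * W b d = W (a + b)%R (c + d + cocycle a b)%R.
Hypothesis W_surj : forall g, exists a c, g = W a c.

Lemma W0 : W 0%R 0%R = 1.
Proof.
apply: (mulgI (W 0%R 0%R)); rewrite WM mulg1 !addr0.
by congr W; apply/rowP => e; rewrite !mxE mul0r addr0.
Qed.

Lemma cocycle0l b : cocycle 0%R b = 0%R.
Proof. by apply/rowP => e; rewrite !mxE mul0r. Qed.

Lemma cocycle0r b : cocycle b 0%R = 0%R.
Proof. by apply/rowP => e; rewrite !mxE mulr0. Qed.

Lemma cocycleNr a b : cocycle a (- b)%R = (- cocycle a b)%R.
Proof. by apply/rowP => e; rewrite !mxE mulrN. Qed.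

Lemma cocycleNl a b : cocycle (- a)%R b = (- cocycle a b)%R.
Proof. by apply/rowP => e; rewrite !mxE mulNr. Qed.

Lemma WV a c : (W a c)^-1 = W (- a)%R (- c + cocycle a a)%R.
Proof.
apply: mulg1_eq; rewrite WM -W0 subrr; congr W.
by rewrite cocycleNr addrA subrr add0r subrr.
Qed.

Lemma WVM a c b d : (W a c)^-1 * W b d =
  W (b - a)%R (d - c + (cocycle a a - cocycle a b))%R.
Proof.
rewrite WV WM cocycleNl [(- a + b)%R]addrC; congr W.
by rewrite [(d - c)%R]addrC !addrA; congr (_ - _)%R; rewrite addrAC.
Qed.

Lemma WR a c b d : [~ W a c, W b d] = W 0%R (wedge a b).
Proof.
rewrite commgEl conjgE; apply: (mulgI (W a c)); rewrite mulVKg.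
apply: (mulgI (W b d)); rewrite mulVKg mulgA !WM cocycle0r !addr0 addrC.
congr W; apply/rowP => e; rewrite !mxE; ring.
Qed.

Section OneSubgroup.
Variables (H : set G) (n : nat).
Hypotheses (Hsub : is_subgroup H) (Hconj : forall g h, H g -> H (g ^ h)).
Hypothesis Hn : has_index H n.

Let H1 : H 1. Proof. by have [] := (is_subgroupP H).1 Hsub. Qed.
Let HM g h : H g -> H h -> H (g * h).
Proof. by have [_ + _] := (is_subgroupP H).1 Hsub; apply. Qed.
Let HV g : H g -> H g^-1.
Proof. by have [_ _] := (is_subgroupP H).1 Hsub; apply. Qed.

Definition central_part : set 'rV[int]_6 := [set c | H (W 0%R c)].

Definition abelian_part : set 'rV[int]_4 := [set a | exists c, H (W a c)].

Lemma lattice_central_part : lattice central_part.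
Proof.
split=> [|c d Hc Hd]; first by rewrite /central_part /= W0.
have := HM (HV Hd) Hc; rewrite WVM subr0 cocycle0l subr0 addr0//.
Qed.

Lemma lattice_abelian_part : lattice abelian_part.
Proof.
split=> [|a b [c Hc] [d Hd]]; first by exists 0%R; rewrite W0.
by have := HM (HV Hd) Hc; rewrite WVM; eexists; eassumption.
Qed.

Lemma central_part_full : full_rank central_part.
Proof.
move=> c; have [i [j [ij]]] := coset_collision Hsub Hn (fun k => W 0%R (c *+ k)).
rewrite WVM subr0 cocycle0l subr0 addr0 => Hk.
by exists (j - i)%N; [rewrite subn_gt0 | rewrite mulrnBr// ltnW].
Qed.

Lemma abelian_part_full : full_rank abelian_part.
Proof.
move=> a; have [i [j [ij]]] := coset_collision Hsub Hn (fun k => W (a *+ k) 0%R).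
rewrite WVM => Hk; exists (j - i)%N; first by rewrite subn_gt0.
by rewrite mulrnBr ?(ltnW ij)//; eexists; exact: Hk.
Qed.

(** H contains the commutators of its elements with all of G. *)
Lemma abelian_sub_centralizing : abelian_part `<=` centralizing central_part.
Proof.
move=> a [c Hc] b; rewrite /central_part /=.
rewrite -(WR a c b 0%R) commgEl; apply: HM; first exact: HV.
exact: Hconj.
Qed.

End OneSubgroup.

Definition hermite_generators (BQ : 'M[int]_4) (BN : 'M[int]_6) (C : 'M[int]_(4, 6)) : set G :=
  [set W (row i (BQ *m central_basis BN)%R) (row i C) | i in setT]
    `|` [set W 0%R v | v in row_lattice BN].

Definition hermite_subgroup BQ BN C : set G :=
  smallest (@is_subgroup G) (hermite_generators BQ BN C).

(** The decomposition of a normal subgroup of finite index into the bases of N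
    and of M relative to X(N), and lifts C reduced modulo N.  The bound on n
    comes from the words whose exponents lie in the boxes of the pivots of M and
    N: they lie in distinct cosets. *)
Lemma hermite_subgroup_exists (H : set G) n : is_normal_subgroup H -> has_index H n ->
  exists (BQ : 'M[int]_4) (BN : 'M[int]_6) (C : 'M[int]_(4, 6)), [/\ hermite BQ, hermite BN,
    (forall i e, 0 <= C i e < BN e e)%R, H = hermite_subgroup BQ BN C &
    [/\ hermite (central_basis BN),
      (forall e, BN e e %| central_basis BN (edge_lo e) (edge_lo e))%Z,
      (forall e, BN e e %| central_basis BN (edge_hi e) (edge_hi e))%Z &
      (\prod_i (`|BQ i i| * `|central_basis BN i i|) * \prod_e `|BN e e| <= n)%N]].
Proof.
move=> [Hsub Hconj] Hn.
have lN := lattice_central_part Hsub; have fN := central_part_full Hsub Hn.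
have lM := lattice_abelian_part Hsub; have fM := abelian_part_full Hsub Hn.
have MX := abelian_sub_centralizing Hsub Hconj.
set N := central_part H in lN fN MX; set M := abelian_part H in lM fM MX.
have [BN hBN NE] := hermite_exists lN fN.
have [hBX XE] : hermite (central_basis BN) /\
    centralizing (row_lattice BN) = row_lattice (central_basis BN).
  rewrite /central_basis; apply: (@xgetPex _ 0%R [set B : 'M[int]_4 | hermite B /\
    centralizing (row_lattice BN) = row_lattice B]).
  have [|v|B hB XE] := @hermite_exists _ (centralizing N).
  - exact: lattice_centralizing.
  - by have [k k0 /MX Xk] := fM v; exists k.
  - by exists B; rewrite -NE.
set BX := central_basis BN in hBX XE *.
have [||BQ hBQ QE] := @hermite_exists _ [set u | M (u *m BX)%R].
- split=> [|u v] /=; first by rewrite mul0mx; case: lM.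
  by rewrite mulmxBl; apply: lM.2.
- move=> v; have [k k0 Mk] := fM (v *m BX)%R; exists k => //=.
  by rewrite -scaler_nat -scalemxAl scaler_nat.
have [RT RD] := triangularM hBQ.1 hBX.1; set R := (BQ *m BX)%R in RT RD.
have ME : M = row_lattice R.
  apply/seteqP; split=> [a Ma|_ [u _ <-]].
    have : row_lattice BX a by rewrite -XE -NE; exact: MX.
    case=> u _ ua; have : [set u | M (u *m BX)%R] u by rewrite /= ua.
    by rewrite QE => -[w _ wu]; exists w => //; rewrite mulmxA wu.
  by rewrite mulmxA; apply: (_ : [set u | M (u *m BX)%R] _); rewrite QE; exists u.
have [H1 HM HV] := (is_subgroupP H).1 Hsub.
have lift (i : 'I_4) : exists c, H (W (row i R) c) /\
    forall e, (0 <= c ord0 e < BN e e)%R.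
  have : M (row i R) by rewrite ME; exists (delta_mx 0%R i) => //; rewrite -rowE.
  case=> c Hc; have [u _ ub] := triangular_reduce 0 c hBN.1.
  exists (c - u *m BN)%R; split=> [|e]; last exact: ub.
  have Nu : N (- (u *m BN))%R.
    by rewrite -sub0r; apply: lN.2; [case: lN | rewrite NE; exists u].
  by have := HM _ _ Hc Nu; rewrite WM cocycle0r !addr0.
have [Cf HC] := boolp.choice lift.
pose C : 'M[int]_(4, 6) := (\matrix_i Cf i)%R.
exists BQ, BN, C; split=> //.
- by move=> i e; rewrite mxE; have [_] := HC i; exact.
(* an element of H agrees with one of the generated subgroup in its Z^4
   coordinate, and the quotient of the two is in the central part *)
- have DH : hermite_subgroup BQ BN C `<=` H.
    apply: smallest_sub => // g [[i _ <-]|[v vN <-]].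
      by rewrite rowK; have [] := HC i.
    by move: vN; rewrite -NE.
  have Dsub := is_subgroup_smallest (hermite_generators BQ BN C).
  have [D1 DM DV] := (is_subgroupP _).1 Dsub.
  apply/seteqP; split=> // g Hg; have [a [c ge]] := W_surj g.
  have : M a by exists c; rewrite -ge.
  rewrite ME => Ra; have : abelian_part (hermite_subgroup BQ BN C) a.
    apply: row_lattice_sub Ra; first exact: lattice_abelian_part.
    move=> i; exists (row i C); apply: sub_gen_smallest; left; exists i => //.
  case=> c' Dc; have Hc := DH _ Dc.
  have : N (c - c')%R.
    have := HM _ _ (HV _ Hc) Hg; rewrite ge WVM subrr subrr addr0; exact.
  rewrite NE => Nc.
  have -> : g = W a c' * W 0%R (c - c')%R.
    by rewrite WM cocycle0r !addr0 addrC subrK.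
  by apply: DM => //; apply: sub_gen_smallest; right; exists (c - c')%R.
have rowX i : centralizing N (row i BX).
  by rewrite NE XE; exists (delta_mx 0%R i) => //; rewrite -rowE.
have row0 (i j : 'I_4) : (j < i)%N -> row i BX 0%R j = 0%R.
  by move=> ji; rewrite mxE hBX.1.2.
split=> //.
- move=> e; have := rowX (edge_lo e) (delta_mx 0%R (edge_hi e)); rewrite NE => -[u _ uw].
  have [l0 le] := wedge_lead_lo (row0 (edge_lo e)).
  rewrite -uw in l0 le; have := triangular_lead0 hBN.1 l0.
  by rewrite le mxE => /eqP; rewrite eqr_oppLR => /eqP ->; rewrite -mulNr dvdz_mull.
- move=> e; have := rowX (edge_hi e) (delta_mx 0%R (edge_lo e)); rewrite NE => -[u _ uw].
  have [l0 le] := wedge_lead_hi (row0 (edge_hi e)).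
  rewrite -uw in l0 le; have := triangular_lead0 hBN.1 l0.
  by rewrite le mxE => ->; rewrite dvdz_mull.
(* words with exponents in the boxes, indexed by finite dependent functions *)
pose p (i : 'I_4) := (`|BQ i i| * `|BX i i|)%N; pose q (e : 'I_6) := `|BN e e|%N.
rewrite -(card_dffun_ord p) -(card_dffun_ord q) -card_prod.
pose ra (t : {dffun forall i, 'I_(p i)}) : 'rV[int]_4 := (\row_i (t i : nat)%:Z)%R.
pose rc (t : {dffun forall e, 'I_(q e)}) : 'rV[int]_6 := (\row_e (t e : nat)%:Z)%R.
apply: (coset_separated_le Hsub Hn (f := fun t => W (ra t.1) (rc t.2))).
move=> [a c] [b d] /=; rewrite WVM => Habcd.
have ab : (ra b - ra a)%R = 0%R.
  apply: (triangular_small RT); first by rewrite -ME; eexists; exact: Habcd.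
  move=> i; have -> : R i i = Posz (p i).
    by rewrite RD /p PoszM !gez0_abs// ltW ?hBQ.1.1 ?hBX.1.1.
  by rewrite !mxE; apply: dist_lt_nat.
have {ab} ab : a = b.
  apply/ffunP => i; apply: val_inj; move/rowP: ab => /(_ i); rewrite !mxE.
  by move/eqP; rewrite subr_eq0 => /eqP[]; exact: esym.
move: Habcd; rewrite ab !subrr addr0 => Hcd.
congr (_, _); have cd : (rc d - rc c)%R = 0%R.
  apply: (triangular_small hBN.1); first by rewrite -NE.
  move=> e; have -> : BN e e = Posz (q e) by rewrite /q gez0_abs// ltW ?hBN.1.1.
  by rewrite !mxE; apply: dist_lt_nat.
apply/ffunP => e; apply: val_inj; move/rowP: cd => /(_ e); rewrite !mxE.
by move/eqP; rewrite subr_eq0 => /eqP[]; exact: esym.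
Qed.

End NormalSubgroupStructure.

(** * The group F_(2,4) and its abelian quotients *)
Lemma dvdz_add (d m n : int) : (d %| m)%Z -> (d %| n)%Z -> (d %| (m + n)%R)%Z.
Proof. exact: rpredD. Qed.

Lemma dvdz_opp (d m : int) : (d %| (- m)%R)%Z = (d %| m)%Z.
Proof. by rewrite !dvdzE abszN. Qed.

Section ResidueSubgroups.
Local Open Scope group_scope.
Local Open Scope classical_set_scope.
Variables (G : groupType) (f : G -> int).
Hypothesis fM : forall g h, f (g * h) = (f g + f h)%R.

Lemma int_char1 : f 1 = 0%R.
Proof. by have := fM 1 1; rewrite mulg1; lia. Qed.

Lemma int_charV g : f g^-1 = (- f g)%R.
Proof. by have := fM g g^-1; rewrite mulgV int_char1; lia. Qed.

Lemma int_charX g k : f (g ^+ k) = (f g *+ k)%R.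
Proof.
elim: k => [|k IH]; first by rewrite expg0 int_char1.
by rewrite expgS fM IH mulrS.
Qed.

Lemma int_charR g h : f [~ g, h] = 0%R.
Proof. by rewrite commgEl conjgE !fM !int_charV; lia. Qed.

Definition residue_subgroup (n : nat) : set G := [set g | (n %| f g)%Z].

Lemma residue_subgroup_normal n : is_normal_subgroup (residue_subgroup n).
Proof.
rewrite /residue_subgroup; split; [apply/is_subgroupP; split|] => /=.
- by rewrite int_char1 dvdz0.
- by move=> g h ng nh; rewrite fM dvdz_add.
- by move=> g ng; rewrite int_charV dvdz_opp.
- by move=> g h; rewrite conjgE !fM int_charV addrCA addNr addr0.
Qed.

(** The cosets are those of x^k for 0 <= k < n. *)
Lemma residue_subgroup_index n x : (0 < n)%N -> f x = 1%R ->
  has_index (residue_subgroup n) n.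
Proof.
move=> n0 fx; rewrite /has_index.
set H := residue_subgroup n; pose F (k : nat) := [set (x ^+ k * h) | h in H].
have fxk k : f (x ^+ k) = Posz k by rewrite int_charX fx natz.
have -> : left_cosets H = F @` `I_n.
  apply/seteqP; split=> [_ [g _ <-]|_ [k _ <-]]; last by exists (x ^+ k).
  have r0 : (0 <= (f g %% n)%Z)%R by rewrite modz_ge0// -lt0n.
  exists `|(f g %% n)%Z|%N.
    by rewrite /= -ltz_nat abszE ger0_norm// ltz_pmod.
  have Hd : H (x ^+ `|(f g %% n)%Z| * g^-1).
    rewrite /H /residue_subgroup /= fM int_charV fxk abszE ger0_norm//.
    by rewrite -dvdz_opp opprB -eqz_mod_dvd modz_mod.
  have Hc (u v : G) h : H (u * v^-1) -> H h -> H (v^-1 * u * h).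
    by rewrite /H /residue_subgroup /= !fM !int_charV [(f u - _)%R]addrC; exact: dvdz_add.
  apply/seteqP; split=> _ [h Hh <-].
    exists (g^-1 * x ^+ `|(f g %% n)%Z| * h); first exact: Hc.
    by rewrite -mulgA mulVKg.
  exists ((x ^+ `|(f g %% n)%Z|)^-1 * g * h); last by rewrite -mulgA mulVKg.
  apply: Hc => //; have [/is_subgroupP[_ _ HV] _] := residue_subgroup_normal n.
  by have := HV _ Hd; rewrite invgM invgK.
apply: inj_card_eq => k l; rewrite !in_setE /= => kn ln Fkl.
have : F l (x ^+ k).
  by rewrite -Fkl; exists 1; rewrite ?mulg1// /H /residue_subgroup /= int_char1 dvdz0.
case=> h; rewrite /H /residue_subgroup /= => nh /(congr1 f).
rewrite fM !fxk => e.
have : (Posz k == l %[mod n])%Z by rewrite eqz_mod_dvd -e addrC addKr.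
by rewrite !modz_nat eqz_nat !modn_small// => /eqP.
Qed.

End ResidueSubgroups.

Section FreeNilpotent.
Local Open Scope group_scope.
Local Open Scope classical_set_scope.

Let F := free_group 'I_4.
Let G := free_nilpotent 2 4.
Let proj (u : F) : G := quotient_proj _ u.

Lemma projM u v : proj (u * v) = proj u * proj v.
Proof. exact/esym/quotient_mulE. Qed.

Lemma projV u : proj u^-1 = (proj u)^-1.
Proof. exact/esym/quotient_invE. Qed.

Lemma projR u v : proj [~ u, v] = [~ proj u, proj v].
Proof. by rewrite !commgEl !conjgE !projM !projV. Qed.

Lemma proj_surj g : exists u, g = proj u.
Proof. by exists (repr g); rewrite -[LHS]quotient_reprK. Qed.

Definition generator (i : 'I_4) : G := proj (free_proj [:: (i, false)]).

Lemma free_cons (l : 'I_4 * bool) w :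
  free_proj (l :: w) = free_proj [:: l] * free_proj w.
Proof. by apply/esym; rewrite -cat1s; exact: free_mulE. Qed.

Lemma free_letterV (i : 'I_4) :
  free_proj [:: (i, true)] = (free_proj [:: (i, false)])^-1.
Proof. exact/esym/free_invE. Qed.

Lemma generator_generates (K : set G) : is_subgroup K ->
  (forall i, K (generator i)) -> forall g, K g.
Proof.
move=> /is_subgroupP[K1 KM KV] Kx g; have [u ->] := proj_surj g.
rewrite -(free_reprK u); elim: (repr u) => [|[i b] w IH].
  suff -> : proj (free_proj [::]) = 1 by [].
  by [].
rewrite free_cons projM; apply: KM => //; case: b; last exact: Kx.
by rewrite free_letterV projV; apply: KV; exact: Kx.
Qed.

Lemma comm_central_free_nilpotent (a b g : G) : [~ a, b] * g = g * [~ a, b].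
Proof.
have [u ->] := proj_surj a; have [v ->] := proj_surj b; have [w ->] := proj_surj g.
suff e : proj [~ [~ u, v], w] = 1.
  rewrite !projR in e; apply: etrans (commgC _ _) _.
  by apply: etrans (congr1 (fun z => proj w * [~ proj u, proj v] * z) e) (mulg1 _).
rewrite -[RHS]/(proj 1); apply/quotient_projP; rewrite mulg1.
have [/is_subgroupP[_ _ LV] _] := @lower_central_normal F 3.
apply: LV; apply: sub_gen_smallest; exists [~ u, v]; last by exists w.
by apply: sub_gen_smallest; exists u => //; exists v.
Qed.

Definition word_exponent (i : 'I_4) (w : word 'I_4) : int :=
  (\sum_(l <- w) (if l.1 == i then (-1) ^+ l.2 else 0))%R.

Lemma word_exponent_eq i v w : word_eq v w -> word_exponent i v = word_exponent i w.
Proof.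
elim=> [//|a b _ ->//|a b c _ -> _ ->//|a b x e].
rewrite /word_exponent !big_cat !big_cons big_nil /=; congr (_ + _)%R.
by case: (x == i); case: e; rewrite ?addr0 ?add0r //= ?addrA ?addrN ?addNr ?add0r.
Qed.

Definition exponent i (g : G) : int := word_exponent i (repr (repr g : F)).

Lemma exponent_free_projE i w : word_exponent i (repr (free_proj w)) = word_exponent i w.
Proof. by apply: word_exponent_eq; apply/free_projP; rewrite free_reprK. Qed.

Lemma exponent_free_projM i (u v : F) : word_exponent i (repr (u * v)) =
  (word_exponent i (repr u) + word_exponent i (repr v))%R.
Proof.
rewrite -[u in LHS]free_reprK -[v in LHS]free_reprK.
have -> : free_proj (repr u) * free_proj (repr v) = free_proj (repr u ++ repr v).
  exact: free_mulE.
by rewrite exponent_free_projE /word_exponent big_cat.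
Qed.

(** Exponent sums do not depend on representatives, as they vanish on
    commutators and therefore on the third term of the lower central series. *)
Lemma exponent_proj i u : exponent i (proj u) = word_exponent i (repr u).
Proof.
rewrite /exponent; set v := repr (proj u).
have : proj v = proj u by exact: quotient_reprK.
have fM := exponent_free_projM i.
move/quotient_projP => Lvu.
have : [set a | word_exponent i (repr (a : F)) = 0%R] (v^-1 * u).
  move: Lvu; apply: smallest_sub.
    apply/is_subgroupP; split=> /= [|a b a0 b0|a a0].
    - exact: (int_char1 fM).
    - by rewrite fM a0 b0.
    - by rewrite (int_charV fM) a0 oppr0.
  by move=> _ [a _ [b _ <-]]; exact: (int_charR fM).
rewrite /= fM (int_charV fM); lia.
Qed.

Lemma exponentM i g h : exponent i (g * h) = (exponent i g + exponent i h)%R.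
Proof.
have [u ->] := proj_surj g; have [v ->] := proj_surj h.
by rewrite -projM !exponent_proj exponent_free_projM.
Qed.

Lemma exponent_generator i j : exponent i (generator j) = (j == i)%:R%R.
Proof.
rewrite exponent_proj exponent_free_projE /word_exponent big_seq1 /=.
by case: eqP.
Qed.

(** The coefficient 1 on the first exponent makes the characters surjective and
    pairwise non-proportional modulo n. *)
Definition linear_char (n : nat) (b : 'I_n * 'I_n * 'I_n) (g : G) : int :=
  (exponent (@Ordinal 4 0 isT) g + b.1.1%:Z * exponent (@Ordinal 4 1 isT) g +
   b.1.2%:Z * exponent (@Ordinal 4 2 isT) g + b.2%:Z * exponent (@Ordinal 4 3 isT) g)%R.

Lemma linear_charM n b g h :
  @linear_char n b (g * h) = (linear_char b g + linear_char b h)%R.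
Proof. by rewrite /linear_char !exponentM; ring. Qed.

Lemma residue_subgroup_inj n :
  injective (fun b : 'I_n * 'I_n * 'I_n => residue_subgroup (linear_char b) n).
Proof.
move=> b c bc.
(* x_j x_0^(-k), with k the coefficient of b at j, lies in the kernel for b, and
   its value under c is the difference of the two coefficients *)
have key (j : 'I_4) (k l : 'I_n) :
    (forall g, g = generator j * (generator (@Ordinal 4 0 isT) ^+ k)^-1 ->
      linear_char b g = 0%R /\ linear_char c g = (l%:Z - k%:Z)%R) -> l = k.
  move=> /(_ _ erefl); set g := _ * _ => -[bg cg].
  have : residue_subgroup (linear_char b) n g by rewrite /residue_subgroup /= bg dvdz0.
  rewrite bc /residue_subgroup /= cg -eqz_mod_dvd !modz_nat eqz_nat.
  by rewrite !modn_small// => /eqP/ord_inj.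
have ev d j (k : 'I_n) : linear_char d (generator j * (generator (@Ordinal 4 0 isT) ^+ k)^-1) =
   (linear_char d (generator j) - k%:Z)%R.
  rewrite linear_charM (int_charV (linear_charM d)) (int_charX (linear_charM d)).
  have -> : linear_char d (generator (@Ordinal 4 0 isT)) = 1%R.
    by rewrite /linear_char !exponent_generator /= !mulr0 !addr0.
  by rewrite natz.
case: b c bc key ev => [[b1 b2] b3] [[c1 c2] c3] bc key ev; congr (_, _, _); apply/esym.
- apply: (key (@Ordinal 4 1 isT)) => g ->; rewrite !ev /linear_char !exponent_generator /=; lia.
- apply: (key (@Ordinal 4 2 isT)) => g ->; rewrite !ev /linear_char !exponent_generator /=; lia.
- apply: (key (@Ordinal 4 3 isT)) => g ->; rewrite !ev /linear_char !exponent_generator /=; lia.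
Qed.

Lemma num_normal_subgroups_ge n : (0 < n)%N ->
  finite_set [set H : set G | is_normal_subgroup H /\ has_index H n] ->
  (n ^ 3 <= num_normal_subgroups G n)%N.
Proof.
move=> n0 fin; rewrite /num_normal_subgroups.
pose res (b : 'I_n * 'I_n * 'I_n) := residue_subgroup (linear_char b) n.
have -> : (n ^ 3 = #|` [fset res b | b in {: 'I_n * 'I_n * 'I_n}]%fset|)%N.
  rewrite card_imfset /=; last exact: residue_subgroup_inj.
  by rewrite -cardE !card_prod !card_ord !expnS expn0 muln1 mulnA.
apply: fsubset_leq_card; apply/fsubsetP => H /imfsetP[b _ ->].
rewrite in_fset_set// in_setE; split; first exact/residue_subgroup_normal/linear_charM.
apply: (residue_subgroup_index (linear_charM b) (x := generator (@Ordinal 4 0 isT))) => //.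
by rewrite /linear_char !exponent_generator /= !mulr0 !addr0.
Qed.

End FreeNilpotent.

(** * Counting normal subgroups by their codes *)
Section Codes.

(** Pivots are stored as predecessors p with value p + 1, so that they are
    positive by construction.  The code of a Hermite matrix with given pivots is
    its strict upper part; on and below the diagonal the range is 'I_1. *)
Definition off_diagonal r (p : 'I_r -> nat) (ij : 'I_r * 'I_r) : nat :=
  if (ij.1 < ij.2)%N then p ij.2 else 0.

Definition hermite_code r (p : 'I_r -> nat) :=
  {dffun forall ij : 'I_r * 'I_r, 'I_(off_diagonal p ij).+1}.

Definition hermite_of_code r (p : 'I_r -> nat) (f : hermite_code p) : 'M[int]_r :=
  (\matrix_(i, j) if i == j then Posz (p j).+1 else Posz (f (i, j)))%R.

Lemma hermite_of_code_surj r (p : 'I_r -> nat) (B : 'M[int]_r) : hermite B ->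
  (forall j, B j j = Posz (p j).+1) -> exists f, B = hermite_of_code (p := p) f.
Proof.
move=> [[_ B0] Bb] Bp.
pose f : hermite_code p := finfun (fun ij : 'I_r * 'I_r =>
  (inord `|B ij.1 ij.2|%N : 'I_(off_diagonal p ij).+1)).
exists f; apply/matrixP => i j; rewrite mxE ffunE.
have [->|ij] := eqVneq i j; first exact: Bp.
case: (ltngtP i j) => [lt|gt|/ord_inj e]; last by rewrite e eqxx in ij.
  have := Bb i j lt; rewrite Bp => /andP[b0 bp].
  rewrite inordK ?gez0_abs//= /off_diagonal /= lt; lia.
by rewrite /= B0// inordK.
Qed.

Lemma card_hermite_code r (p : 'I_r -> nat) :
  #|{: hermite_code p}| = \prod_j (p j).+1 ^ j.
Proof.
rewrite /hermite_code card_dffun_ord.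
rewrite -(pair_bigA _ (fun i j => (off_diagonal p (i, j)).+1)) exchange_big /=.
apply: eq_bigr => j _; rewrite /off_diagonal /=.
under eq_bigr do rewrite (fun_if succn).
rewrite -big_mkcond /= prod_nat_const; congr (_ ^ _).
rewrite -sum1_card -(big_ord_widen r (fun=> 1%N) (ltnW (ltn_ord j))).
by rewrite sum1_card card_ord.
Qed.

Definition lift_code r k (p : 'I_k -> nat) :=
  {dffun forall ij : 'I_r * 'I_k, 'I_(p ij.2).+1}.

Definition lift_of_code r k (p : 'I_k -> nat) (f : lift_code r p) : 'M[int]_(r, k) :=
  (\matrix_(i, j) Posz (f (i, j)))%R.

Lemma lift_of_code_surj r k (p : 'I_k -> nat) (C : 'M[int]_(r, k)) :
  (forall i j, 0 <= C i j < Posz (p j).+1)%R ->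
  exists f, C = lift_of_code (p := p) f.
Proof.
move=> Cb.
pose f : lift_code r p := finfun (fun ij : 'I_r * 'I_k =>
  (inord `|C ij.1 ij.2|%N : 'I_(p ij.2).+1)).
exists f; apply/matrixP => i j; rewrite mxE ffunE /=.
have /andP[c0 cp] := Cb i j; rewrite inordK ?gez0_abs//; lia.
Qed.

Lemma card_lift_code r k (p : 'I_k -> nat) :
  #|{: lift_code r p}| = \prod_j (p j).+1 ^ r.
Proof.
rewrite /lift_code card_dffun_ord.
rewrite -(pair_bigA _ (fun (i : 'I_r) j => (p j).+1)) exchange_big /=.
by apply: eq_bigr => j _; rewrite prod_nat_const card_ord.
Qed.

End Codes.

Section Counting.
Local Open Scope classical_set_scope.
Variables (G : groupType) (W : 'rV[int]_4 -> 'rV[int]_6 -> G).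
Hypothesis WM : forall a c b d,
  (W a c * W b d)%g = W (a + b)%R (c + d + cocycle a b)%R.
Hypothesis W_surj : forall g, exists a c, g = W a c.
Variable T : nat.

(** Nested in the order in which the sum over pivots is organized; see
    [edge_pivot] for the access by colexicographic rank. *)
Definition edge_pivots : finType :=
  ('I_T * ('I_T * ('I_T * ('I_T * ('I_T * 'I_T)))))%type.

Definition edge_pivot (t : edge_pivots) (e : 'I_6) : nat :=
  let: (n23, (n13, (n03, (n02, (n01, n12))))) := t in
  tnth [tuple n01 : nat; n02 : nat; n12 : nat; n03 : nat; n13 : nat; n23 : nat] e.

Definition vertex_pivot (q : {ffun 'I_4 -> 'I_T}) (i : 'I_4) : nat := q i.

Definition pivots : finType := ({ffun 'I_4 -> 'I_T} * edge_pivots)%type.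

Definition code (d : pivots) : finType :=
  (hermite_code (vertex_pivot d.1) * hermite_code (edge_pivot d.2) *
   lift_code 4 (edge_pivot d.2))%type.

Definition subgroup_of_code (d : pivots) (c : code d) : set G :=
  hermite_subgroup W (hermite_of_code c.1.1) (hermite_of_code c.1.2) (lift_of_code c.2).

(** The lower bound for |Z^4 : X(N)| by least common multiples; at the second
    vertex the single pivot n_13 is used. *)
Definition centralizing_index (t : edge_pivots) : nat :=
  let: (n23, (n13, (n03, (n02, (n01, n12))))) := t in
  (lcmn n01.+1 (lcmn n02.+1 n03.+1) * n13.+1 * lcmn n12.+1 n23.+1 *
    lcmn n03.+1 (lcmn n13.+1 n23.+1))%N.

Definition index_bound (d : pivots) : nat :=
  (\prod_i (d.1 i).+1 * centralizing_index d.2 * \prod_e (edge_pivot d.2 e).+1)%N.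

Definition code_count (d : pivots) : nat :=
  (\prod_i (d.1 i).+1 ^ i * \prod_e (edge_pivot d.2 e).+1 ^ (e + 4))%N.

Lemma card_code d : #|{: code d}| = code_count d.
Proof.
rewrite /code !card_prod !card_hermite_code card_lift_code -mulnA.
congr (_ * _)%N; rewrite -big_split /=; apply: eq_bigr => e _.
by rewrite expnD.
Qed.

Lemma subgroup_code_exists (H : set G) m : is_normal_subgroup H ->
  has_index H m -> (m <= T)%N ->
  exists (d : pivots) (c : code d), H = subgroup_of_code c /\ (index_bound d <= m)%N.
Proof.
move=> Hn Hm mT.
have [BQ [BN [C [hQ hN hC HE [hX dlo dhi le]]]]] := hermite_subgroup_exists WM W_surj Hn Hm.
set BX := central_basis BN in hX dlo dhi le.
have Qp i : (0 < `|BQ i i|)%N by rewrite absz_gt0 gt_eqF ?hQ.1.1.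
have Np i : (0 < `|BN i i|)%N by rewrite absz_gt0 gt_eqF ?hN.1.1.
have Xp i : (0 < `|BX i i|)%N by rewrite absz_gt0 gt_eqF ?hX.1.1.
have PQX : (0 < \prod_i (`|BQ i i| * `|BX i i|))%N.
  by rewrite prodn_gt0// => i; rewrite muln_gt0 Qp Xp.
have PN : (0 < \prod_e `|BN e e|)%N by rewrite prodn_gt0.
have Qm i : (`|BQ i i|.-1 < T)%N.
  rewrite prednK//; apply: leq_trans mT; apply: leq_trans le.
  rewrite dvdn_leq ?muln_gt0 ?PQX// dvdn_mulr// (bigD1 i)//=.
  by rewrite dvdn_mulr// dvdn_mulr.
have Nm e : (`|BN e e|.-1 < T)%N.
  rewrite prednK//; apply: leq_trans mT; apply: leq_trans le.
  rewrite dvdn_leq ?muln_gt0 ?PQX// dvdn_mull// (bigD1 e)//=.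
  by rewrite dvdn_mulr.
pose o e := Ordinal (Nm e); pose E k h := @Ordinal 6 k h.
pose t : edge_pivots := (o (E 5 isT), (o (E 4 isT), (o (E 3 isT),
  (o (E 1 isT), (o (E 0 isT), o (E 2 isT))))))%N.
pose d : pivots := ([ffun i => Ordinal (Qm i)], t).
have dN e : BN e e = Posz (edge_pivot d.2 e).+1.
  have -> : edge_pivot d.2 e = `|BN e e|.-1.
    by case: e => -[|[|[|[|[|[|//]]]]]] h; rewrite /edge_pivot /=; congr (`|BN _ _|.-1); apply: val_inj.
  by rewrite prednK// gez0_abs// ltW ?hN.1.1.
have dQ i : BQ i i = Posz (vertex_pivot d.1 i).+1.
  by rewrite /vertex_pivot ffunE /= prednK// gez0_abs// ltW ?hQ.1.1.
have [fQ QE] := hermite_of_code_surj hQ dQ.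
have [fN NE] := hermite_of_code_surj hN dN.
have [|fC CE] := @lift_of_code_surj _ _ (edge_pivot d.2) C.
  by move=> i e; rewrite -dN.
exists d, (fQ, fN, fC); split; first by rewrite HE QE NE CE.
apply: leq_trans le; rewrite big_split /= /index_bound.
have -> : (\prod_e (edge_pivot d.2 e).+1 = \prod_e `|BN e e|)%N.
  by apply: eq_bigr => e _; rewrite dN.
have -> : (\prod_i (d.1 i).+1 = \prod_i `|BQ i i|)%N.
  by apply: eq_bigr => i _; rewrite dQ.
rewrite leq_mul2r leq_mul2l; apply/orP; right; apply/orP; right.
pose V k h := @Ordinal 4 k h.
have -> : (\prod_i `|BX i i| = `|BX (V 0 isT) (V 0 isT)| * `|BX (V 1 isT) (V 1 isT)| *
   `|BX (V 2 isT) (V 2 isT)| * `|BX (V 3 isT) (V 3 isT)|)%N.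
  rewrite !big_ord_recr big_ord0 /= mul1n.
  by congr (_ * _ * _ * _)%N; congr (`|BX _ _|)%N; apply: val_inj.
have lo (e : 'I_6) (i : 'I_4) : edge_lo e = i :> nat -> (`|BN e e| %| `|BX i i|)%N.
  by move/val_inj<-; exact: dlo.
have hi (e : 'I_6) (i : 'I_4) : edge_hi e = i :> nat -> (`|BN e e| %| `|BX i i|)%N.
  by move/val_inj<-; exact: dhi.
rewrite /centralizing_index /= !prednK//.
apply: leq_mul; [apply: leq_mul; [apply: leq_mul|]|]; apply: dvdn_leq; rewrite ?Xp ?dvdn_lcm//.
- by rewrite !lo.
- by rewrite lo.
- by rewrite hi// lo.
- by rewrite !hi.
Qed.

Definition bounded_index_subgroups : set (set G) :=
  [set H | is_normal_subgroup H /\ exists2 m, (0 < m <= T)%N & has_index H m].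

Lemma finite_bounded_index_subgroups : finite_set bounded_index_subgroups.
Proof.
pose f (x : {d : pivots & code d}) := subgroup_of_code (tagged x).
apply: (@sub_finite_set _ _ (f @` setT)); last exact/finite_image/finite_finset.
move=> H [Hn [m /andP[_ mT] Hm]].
by have [d [c [-> _]]] := subgroup_code_exists Hn Hm mT; exists (existT _ d c).
Qed.

Variable R : realType.
Local Open Scope ring_scope.

(** Each subgroup of index at most T is sent to the pivots of one of its codes.
    The fibres have at most as many elements as there are codes, and the weight
    only grows when the index is replaced by its lower bound. *)
Lemma num_normal_subgroups_sum_le (w : nat -> R) :
  (forall m n, (0 < m <= n)%N -> 0 <= w n <= w m) ->
  \sum_(m < T) (num_normal_subgroups G m.+1)%:R * w m.+1 <=
  \sum_(d : pivots) (code_count d)%:R * w (index_bound d).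
Proof.
move=> wP; set U := fset_set bounded_index_subgroups.
have UE H : (H \in U) = (H \in bounded_index_subgroups).
  by rewrite in_fset_set//; exact: finite_bounded_index_subgroups.
have w0 n : (0 < n)%N -> 0 <= w n.
  by move=> n0; have := wP n n; rewrite n0 leqnn => /(_ isT)/andP[].
have bound0 d : (0 < index_bound d)%N.
  rewrite /index_bound !muln_gt0 !prodn_gt0// andbT /=.
  by case: d.2 => ? [? [? [? [? ?]]]]; rewrite /= !muln_gt0 !lcmn_gt0.
have [T0|T0] := posnP T.
  rewrite big1 ?sumr_ge0// => [d _|[m mT] _]; first by rewrite mulr_ge0 ?w0.
  by exfalso; rewrite T0 in mT.
pose o : 'I_T := Ordinal T0.
have ex_idx (H : set G) : exists i : 'I_T,
    bounded_index_subgroups H -> has_index H i.+1.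
  have [[Hn [m /andP[m0 mT] Hm]]|nH] := pselect (bounded_index_subgroups H).
    have mT' : (m.-1 < T)%N by rewrite prednK.
    by exists (Ordinal mT') => _; rewrite /= prednK.
  by exists o.
have [idx idxP] := boolp.choice ex_idx.
have ex_delta (H : set G) : exists d : pivots, bounded_index_subgroups H ->
    (exists c : code d, H = subgroup_of_code c) /\ (index_bound d <= (idx H).+1)%N.
  have [HB|nH] := pselect (bounded_index_subgroups H); last first.
    by exists ([ffun=> o], (o, (o, (o, (o, (o, o)))))).
  have [d [c [Hc dm]]] := subgroup_code_exists HB.1 (idxP _ HB) (ltn_ord _).
  by exists d => _; split=> //; exists c.
have [delta deltaP] := boolp.choice ex_delta.
(* group first by index, then by pivots *)
apply: le_trans (_ : \sum_(m < T) \sum_(H <- U | idx H == m) w m.+1 <= _).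
  apply: ler_sum => m _; rewrite big_const_seq iter_addr_0 -[leRHS]mulr_natl.
  rewrite ler_wpM2r ?w0// ler_nat -size_filter /num_normal_subgroups.
  have SB : [set H : set G | is_normal_subgroup H /\ has_index H m.+1]
      `<=` bounded_index_subgroups.
    by move=> H [Hn Hm]; split=> //; exists m.+1; rewrite ?ltn_ord.
  apply: uniq_leq_size; first exact: fset_uniq.
  move=> H; rewrite in_fset_set; last first.
    exact: sub_finite_set SB finite_bounded_index_subgroups.
  rewrite in_setE => HS; rewrite mem_filter UE mem_set ?andbT; last exact: SB.
  apply/eqP/val_inj => /=; apply: succn_inj; apply/card_eq_II.
  apply: card_eq_trans HS.2; apply: card_esym; exact: idxP (SB _ HS).
have -> : \sum_(m < T) \sum_(H <- U | idx H == m) w m.+1 =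
    \sum_(H <- U) w (idx H).+1.
  rewrite [RHS](partition_big idx xpredT)//=; apply: eq_bigr => m _.
  by apply: eq_bigr => H /eqP <-.
apply: le_trans (_ : \sum_(H <- U) w (index_bound (delta H)) <= _).
  rewrite big_seq [leRHS]big_seq; apply: ler_sum => H; rewrite UE in_setE => HB.
  have [_ dm] := deltaP H HB.
  by have := wP (index_bound (delta H)) (idx H).+1; rewrite bound0 dm => /(_ isT)/andP[].
rewrite (partition_big delta xpredT)//=; apply: ler_sum => d _.
under eq_bigr => H /eqP -> do [].
rewrite big_const_seq iter_addr_0 -[leLHS]mulr_natl ler_wpM2r ?w0// ler_nat -size_filter.
rewrite -card_code -(size_codom (@subgroup_of_code d)).
apply: uniq_leq_size; first by rewrite filter_uniq// fset_uniq.
move=> H; rewrite mem_filter UE => /andP[/eqP dH]; rewrite in_setE => /deltaP[].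
by rewrite dH => -[c ->] _; apply: codom_f.
Qed.

End Counting.

(** * Convergence of the sum over pivots *)

Section PivotSeries.
Variable R : realType.
Local Open Scope ring_scope.

Lemma edge_prodE T (t : edge_pivots T) (f : nat -> nat -> nat) :
  (\prod_(e < 6) f e (edge_pivot t e))%N =
  let: (n23, (n13, (n03, (n02, (n01, n12))))) := t in
  (f 0 n01 * f 1 n02 * f 2 n12 * f 3 n03 * f 4 n13 * f 5 n23)%N.
Proof.
case: t => n23 [n13 [n03 [n02 [n01 n12]]]].
by rewrite !big_ord_recr big_ord0 /= mul1n !(tnth_nth 0%N).
Qed.

(** Since s > 4, each n_e^(e + 4) n_e^(-s) is at most n_e^e; the remaining power
    of n_13 with exponent -s is the bound for the second pivot of X(N). *)
Lemma edge_sum_le (s : R) T : 4 < s ->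
  \sum_(t : edge_pivots T) (\prod_e (edge_pivot t e).+1 ^ (e + 4))%N%:R *
    (centralizing_index t * \prod_e (edge_pivot t e).+1)%N%:R `^ (- s) <=
  \sum_(n23 < T) n23.+1%:R ^+ 5 *
  (\sum_(n13 < T) n13.+1%:R ^+ 4 * n13.+1%:R `^ (- s) *
   ((\sum_(n03 < T) n03.+1%:R ^+ 3 *
        (lcmn n03.+1 (lcmn n13.+1 n23.+1))%:R `^ (- s) *
     (\sum_(n02 < T) n02.+1%:R *
      (\sum_(n01 < T) (lcmn n01.+1 (lcmn n02.+1 n03.+1))%:R `^ (- s)))) *
    (\sum_(n12 < T) n12.+1%:R ^+ 2 * (lcmn n12.+1 n23.+1)%:R `^ (- s)))).
Proof.
move=> s4.
have pairE (A B : finType) (F : A * B -> R) : \sum_p F p = \sum_a \sum_b F (a, b).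
  by rewrite pair_bigA; apply: eq_bigr => -[].
have x4 (x : nat) : x.+1%:R ^+ 4 * x.+1%:R `^ (- s) <= 1 :> R.
  rewrite -powR_mulrn// -powRD; last by apply/implyP => _; rewrite gt_eqF ?ltr0n.
  by rewrite -[leRHS](powRr0 (x.+1%:R : R)) ler_powR ?ler1n//; lra.
rewrite /edge_pivots pairE; apply: ler_sum => n23 _.
rewrite pairE mulr_sumr; apply: ler_sum => n13 _.
have [S12 E12] : {x : R | x = \sum_(n12 < T) n12.+1%:R ^+ 2 * (lcmn n12.+1 n23.+1)%:R `^ (- s)}.
  by eexists.
rewrite -E12.
rewrite pairE mulr_suml !mulr_sumr; apply: ler_sum => n03 _.
rewrite pairE [_ * (\sum_(_ < T) _) * _]mulrAC !mulr_sumr; apply: ler_sum => n02 _.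
rewrite pairE !mulr_sumr; apply: ler_sum => n01 _.
rewrite [_ * S12 * _]mulrAC E12 !mulr_sumr; apply: ler_sum => n12 _.
rewrite (edge_prodE _ (fun e x => x.+1 ^ (e + 4))%N) (edge_prodE _ (fun e x => x.+1)) /=.
set l1 := lcmn n01.+1 _; set l2 := lcmn n12.+1 _; set l3 := lcmn n03.+1 _.
have -> : (n01.+1 ^ 4 * n02.+1 ^ 5 * n12.+1 ^ 6 * n03.+1 ^ 7 * n13.+1 ^ 8 *
    n23.+1 ^ 9)%N%:R = n01.+1%:R ^+ 4 * n02.+1%:R ^+ 5 * n12.+1%:R ^+ 6 *
    n03.+1%:R ^+ 7 * n13.+1%:R ^+ 8 * n23.+1%:R ^+ 9 :> R.
  by rewrite -!natrX -!natrM.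
rewrite !natrM !powRM ?mulr_ge0//.
have := x4 n01; have := x4 n02; have := x4 n12; have := x4 n03; have := x4 n13; have := x4 n23.
have := powR_ge0 (n01.+1%:R : R) (- s); have := powR_ge0 (n02.+1%:R : R) (- s).
have := powR_ge0 (n03.+1%:R : R) (- s); have := powR_ge0 (n12.+1%:R : R) (- s).
have := powR_ge0 (n13.+1%:R : R) (- s); have := powR_ge0 (n23.+1%:R : R) (- s).
have := powR_ge0 (l1%:R : R) (- s); have := powR_ge0 (l2%:R : R) (- s).
have := powR_ge0 (l3%:R : R) (- s).
move: (l1%:R `^ _) (l2%:R `^ _) (l3%:R `^ _) => p1 p2 p3 h3 h2 h1.
move: (n01.+1%:R `^ _) (n02.+1%:R `^ _) (n12.+1%:R `^ _) => q1 q2 q3.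
move: (n03.+1%:R `^ _) (n13.+1%:R `^ _) (n23.+1%:R `^ _) => q4 q5 q6.
have := ler0n R n01.+1; have := ler0n R n02.+1; have := ler0n R n12.+1.
have := ler0n R n03.+1; have := ler0n R n13.+1; have := ler0n R n23.+1.
move: (n01.+1%:R : R) (n02.+1%:R : R) (n12.+1%:R : R) => x1 x2 x3.
move: (n03.+1%:R : R) (n13.+1%:R : R) (n23.+1%:R : R) => x4' x5 x6.
move=> *.
(* the second factor collects the n_e^4 n_e^(-s), each at most 1 *)
rewrite [leLHS](_ : _ = x6 ^+ 5 * (x5 ^+ 4 * q5 * (x4' ^+ 3 * p3 * (x2 * p1) * (x3 ^+ 2 * p2))) *
  ((x1 ^+ 4 * q1) * (x2 ^+ 4 * q2) * (x3 ^+ 4 * q3) * (x4' ^+ 4 * q4) *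
    (x5 ^+ 4 * q5) * (x6 ^+ 4 * q6))); last by ring.
apply: ler_piMr; repeat first [assumption | apply: mulr_ile1 | apply: exprn_ge0 | apply: mulr_ge0].
Qed.

(** The sum factors: the vertex pivots give partial sums of zeta(s - i) for
    i < 4, and the edge pivots give the sum of [edge_sum_le]. *)
Lemma pivot_series_bounded (s : R) : 4 < s -> exists C : R, forall T,
  \sum_(d : pivots T) (code_count d)%:R * (index_bound d)%:R `^ (- s) <= C.
Proof.
move=> s4; have [C HC] := pivot_sum_bounded s4.
pose Z : R := 1 + (s - 4)^-1; have Z0 : 0 <= Z by rewrite addr_ge0// invr_ge0; lra.
exists (Z ^+ 4 * C) => T.
have -> : \sum_(d : pivots T) (code_count d)%:R * (index_bound d)%:R `^ (- s) =
   (\sum_(q : {ffun 'I_4 -> 'I_T}) \prod_i ((q i).+1%:R ^+ i * (q i).+1%:R `^ (- s))) *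
   \sum_(t : edge_pivots T) (\prod_e (edge_pivot t e).+1 ^ (e + 4))%N%:R *
    (centralizing_index t * \prod_e (edge_pivot t e).+1)%N%:R `^ (- s).
  rewrite big_distrlr /= pair_bigA /=; apply: eq_bigr => -[q t] _ /=.
  rewrite /code_count /index_bound /= -mulnA !natrM powRM ?mulr_ge0// mulrACA.
  congr (_ * _); rewrite big_split /= natr_prod; congr (_ * _).
    by apply: eq_bigr => i _; rewrite natrX.
  apply: (big_morph (fun k : nat => k%:R `^ (- s) : R)) => [k l|]; last by rewrite /= powR1.
  by rewrite natrM powRM.
have -> : \sum_(q : {ffun 'I_4 -> 'I_T}) \prod_i ((q i).+1%:R ^+ i * (q i).+1%:R `^ (- s)) =
    \prod_(i < 4) \sum_(k < T) k.+1%:R ^+ i * k.+1%:R `^ (- s) :> R.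
  by rewrite bigA_distr_bigA.
apply: ler_pM.
- apply: prodr_ge0 => i _; apply: sumr_ge0 => k _; rewrite mulr_ge0 ?powR_ge0//.
- by apply: sumr_ge0 => t _; rewrite mulr_ge0 ?powR_ge0.
- have -> : Z ^+ 4 = \prod_(i < 4) Z by rewrite prodr_const card_ord.
  apply: ler_prod => i _; apply/andP; split.
    by apply: sumr_ge0 => k _; rewrite mulr_ge0 ?powR_ge0.
  apply: le_trans (zeta_partial_sum_le T (_ : 0 < s - 4)); last by lra.
  apply: ler_sum => k _; rewrite -powR_mulrn// -powRD; last first.
    by apply/implyP => _; rewrite gt_eqF ?ltr0n.
  rewrite ler_powR ?ler1n//.
  have : i%:R <= 3 :> R by rewrite ler_nat -ltnS.
  lra.
- by apply: le_trans (HC T); exact: edge_sum_le.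
Qed.

End PivotSeries.

(** * The complex Dirichlet series *)

Section ComplexSeries.
Variable R : realType.
Local Open Scope ring_scope.
Local Open Scope complex_scope.
Local Open Scope classical_set_scope.

(** Stated for every numeric field, so that convergence of real and of complex
    sequences can be compared through the norm. *)
Lemma cvgn_numFieldP (K : numFieldType) (u : nat -> K) : cvgn u <->
  exists l, forall e, 0 < e -> exists N, forall n, (N <= n)%N -> `|l - u n| <= e.
Proof.
split=> [ul|[l ul]].
  exists (limn u) => e e0.
  by move/cvgrPdist_le : ul => /(_ e e0) [N _ HN]; exists N => n; exact: HN.
apply: (cvgP l); apply/cvgrPdist_le => e e0; have [N HN] := ul e e0.
near=> n; apply: HN; near: n; exact: nbhs_infty_ge.
Unshelve. all: by end_near.
Qed.

Lemma cvg_complex (u : nat -> R[i]) :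
  cvgn (fun n => complex.Re (u n)) -> cvgn (fun n => complex.Im (u n)) ->
  cvgn (u : nat -> (R[i] : numFieldType)).
Proof.
move=> /cvgn_numFieldP[a ua] /cvgn_numFieldP[b ub].
apply/(cvgn_numFieldP (K := R[i] : numFieldType) u); exists (a +i* b).
move=> -[e e']; rewrite ltcE /= => /andP[/eqP e'0 e0].
have e2 : 0 < e / 2 by rewrite divr_gt0.
have [N HN] := ua _ e2; have [M HM] := ub _ e2.
exists (maxn N M) => n; rewrite geq_max => /andP[/HN ha /HM hb].
rewrite normc_def e'0 lecR /=.
case: (u n) ha hb => x y /= ha hb.
rewrite -(ger0_norm (ltW e0)) -sqrtr_sqr ler_wsqrtr//.
rewrite -[(a - x) ^+ 2]real_normK ?num_real// -[(b - y) ^+ 2]real_normK ?num_real//.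
have := normr_ge0 (a - x); have := normr_ge0 (b - y); nra.
Qed.

Lemma cvg_Re (u : nat -> R[i]) : cvgn (u : nat -> (R[i] : numFieldType)) ->
  cvgn (fun n => complex.Re (u n)).
Proof.
move=> /(cvgn_numFieldP (K := R[i] : numFieldType) u)[l ul].
apply/cvgn_numFieldP; exists (complex.Re l) => e e0.
have [|N HN] := ul e%:C; first by rewrite ltcR.
exists N => n /HN hn.
have := le_trans (normc_ge_Re _) hn; rewrite lecR.
by case: l {ul HN hn} (u n) => ? ? [].
Qed.

Lemma Re_series (u : nat -> R[i]) n :
  complex.Re (series u n) = series (fun k => complex.Re (u k)) n.
Proof. by rewrite /series /= raddf_sum. Qed.

Lemma Im_series (u : nat -> R[i]) n :
  complex.Im (series u n) = series (fun k => complex.Im (u k)) n.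
Proof. by rewrite /series /= raddf_sum. Qed.

Lemma series_cvg_of_bound (x y : nat -> R) (C : R) :
  (forall n, `|x n| <= y n) -> (forall N, \sum_(k < N) y k <= C) -> cvgn (series x).
Proof.
move=> xy yC; apply: normed_cvg; apply: (series_le_cvg (v_ := y)) => //=.
- by move=> n; exact: le_trans (normr_ge0 _) (xy n).
apply: nondecreasing_is_cvgn.
  by apply: nondecreasing_series => n _ _; exact: le_trans (normr_ge0 _) (xy n).
by exists C => _ [n _ <-]; rewrite /series /= big_mkord.
Qed.

Lemma dirichlet_term_le (a : nat) n (s : R[i]) : (0 < n)%N ->
  `|complex.Re (a%:R * dirichlet_power n s)| <= a%:R * n%:R `^ (- complex.Re s) /\
  `|complex.Im (a%:R * dirichlet_power n s)| <= a%:R * n%:R `^ (- complex.Re s).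
Proof.
move=> n0; rewrite /dirichlet_power /cexp.
have -> : a%:R = (a%:R)%:C :> R[i] by rewrite rmorph_nat.
case: s => x y /=; rewrite !mul0r !mulr0 !subr0 !addr0 !normrM.
rewrite /powR gt_eqF ?ltr0n//.
rewrite (ger0_norm (expR_ge0 _)) (ger0_norm (ler0n _ _)).
by split; rewrite ler_wpM2l// ler_piMr ?expR_ge0 ?cos_max ?sin_max.
Qed.

Local Notation G := (free_nilpotent 2 4).

Lemma dirichlet_cvg_gt4 (s : R[i]) : 4 < complex.Re s ->
  dirichlet_cvg (normal_zeta_coef R G) s.
Proof.
move=> s4; have [C HC] := pivot_series_bounded s4.
pose y n : R := (num_normal_subgroups G n.+1)%:R * n.+1%:R `^ (- complex.Re s).
have yC N : \sum_(k < N) y k <= C.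
  rewrite /y; apply: le_trans (HC N).
  apply: (num_normal_subgroups_sum_le (normal_wordM generator comm_central_free_nilpotent)
    (normal_word_surj generator_generates comm_central_free_nilpotent) N
    (w := fun n => n%:R `^ (- complex.Re s))) => m n /andP[m0 mn].
  rewrite powR_ge0 /= !powRN lef_pV2 ?posrE ?powR_gt0 ?ltr0n ?(leq_trans m0)//.
  by apply: ge0_ler_powR; rewrite ?nnegrE ?ler_nat//; lra.
have xy n := dirichlet_term_le (num_normal_subgroups G n.+1) s (ltn0Sn n).
apply: cvg_complex.
  under eq_fun do rewrite Re_series.
  by apply: (@series_cvg_of_bound _ y C) => // n; exact: (xy n).1.
under eq_fun do rewrite Im_series.
by apply: (@series_cvg_of_bound _ y C) => // n; exact: (xy n).2.
Qed.

Lemma finite_normal_subgroups_index n : (0 < n)%N ->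
  finite_set [set H : set G | is_normal_subgroup H /\ has_index H n].
Proof.
move=> n0; apply: sub_finite_set (finite_bounded_index_subgroups
  (normal_wordM generator comm_central_free_nilpotent)
  (normal_word_surj generator_generates comm_central_free_nilpotent) n).
by move=> H [Hn Hi]; split=> //; exists n; rewrite ?n0 ?leqnn.
Qed.

Lemma dirichlet_term_real (a : nat) n (x : R) : (0 < n)%N ->
  complex.Re (a%:R * dirichlet_power n x%:C) = a%:R * n%:R `^ (- x).
Proof.
move=> n0; rewrite /dirichlet_power /cexp.
have -> : a%:R = (a%:R)%:C :> R[i] by rewrite rmorph_nat.
rewrite /= !mul0r !mulr0 !oppr0 !mul0r !addr0 ?subr0 cos0 mulr1.
by rewrite /powR gt_eqF ?ltr0n.
Qed.

(** From a_n >= n^3, the term of index n at s = 4 is at least 1/n. *)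
Lemma dirichlet_dvg_4 : ~ dirichlet_cvg (normal_zeta_coef R G) 4.
Proof.
move=> /cvg_Re; under eq_fun do rewrite Re_series.
have le n : harmonic n <= complex.Re (normal_zeta_coef R G n.+1 * dirichlet_power n.+1 4).
  have -> : 4 = (4 : R)%:C :> R[i] by rewrite rmorph_nat.
  rewrite dirichlet_term_real// powRN powR_mulrn// /harmonic /=.
  apply: le_trans (_ : (n.+1 ^ 3)%N%:R * (n.+1%:R ^+ 4)^-1 <= _).
    have : n.+1%:R != 0 :> R by rewrite pnatr_eq0.
    rewrite natrX; move: (n.+1%:R : R) => x x0.
    by rewrite le_eqVlt; apply/orP; left; apply/eqP; field.
  rewrite ler_wpM2r ?invr_ge0 ?exprn_ge0// ler_nat num_normal_subgroups_ge//.
  exact: finite_normal_subgroups_index.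
move=> cx; apply: (@dvg_harmonic R); move: cx; apply: series_le_cvg => n.
- exact: harmonic_ge0.
- exact: le_trans (harmonic_ge0 n) (le n).
- exact: le.
Qed.

End ComplexSeries.

Theorem corollary1p6 (R : realType) :
  abscissa_of_convergence (normal_zeta_coef R (free_nilpotent 2 4)) =
  (4%:R : R)%R%:E.
Proof.
apply/eqP; rewrite eq_le; apply/andP; split.
  by apply: ereal_inf_lbound; exists 4%R => // s s4; exact: dirichlet_cvg_gt4.
apply: le_ereal_inf_tmp => _ [x xP <-]; rewrite lee_fin leNgt; apply/negP => x4.
by apply: (@dirichlet_dvg_4 R); apply: xP; rewrite -[4%R in X in (_ < X)%R]/(4%:R)%R raddfMn.
Qed.
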